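(* Let $n$ be an even positive integer, let $t=\nu_2(n)+2$ and $t'=\log_2(n)+2$. Then $$\Phi(n)\leq \begin{cases} 9.625\,n, & \text{if } 16 \nmid n, \\ 2ne^{\gamma}\left(1+\frac{1}{(\log{t'}+\log{\log{t'}})^2}\right)\left(\log{t'}+\log{(\log{t'}+\log{\log{t'}})}\right), & \text{if } 16 \mid n. \end{cases}$$
   Context: For a positive integer $n$, $\Phi(n) := \max\{m \in \mathbb{Z}_{>0} \mid \varphi(m) \text{ divides } 2n\}$, where $\varphi$ is Euler's totient function. $\nu_2(n)$ denotes the $2$-adic valuation of $n$, $\gamma$ is Euler's constant, and $\log$ is the natural logarithm. *)

(* Defs.v *)
From mathcomp Require Import all_boot all_order all_algebra.
From mathcomp Require Import all_classical all_reals all_analysis.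
From mathcomp Require Import zify ring lra.
Set Implicit Arguments. Unset Strict Implicit. Unset Printing Implicit Defensive.
Import Order.TTheory GRing.Theory Num.Theory.
Import numFieldNormedType.Exports.
Local Open Scope classical_set_scope.
Local Open Scope ring_scope.

Definition Phi_pred (n : nat) : pred nat :=
  [pred m : nat | (0 < m)%N && (totient m %| 2 * n)%N].

Lemma Phi_pred_ex (n : nat) : exists m, Phi_pred n m.
Proof. by exists 1%N; exact: (dvd1n (2 * n)). Qed.

Lemma leq_totient_sqr (m : nat) : (0 < m)%N -> (m <= 2 * totient m ^ 2)%N.
Proof.
move=> m0; rewrite totientE // {1}(prod_prime_decomp m0) prime_decompE big_map /=.
set c := (fun p => if p == 2 then 2 else 1)%N.
have H p : p \in primes m ->
    (p ^ logn p m <= c p * (p.-1 * p ^ (logn p m).-1) ^ 2)%N.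
  rewrite mem_primes => /and3P[pp _ pm].
  have : (0 < logn p m)%N by rewrite logn_gt0 mem_primes pp m0.
  case: (logn p m) => // k _ /=.
  rewrite expnS expnMn mulnA; apply: leq_mul.
    by have := prime_gt1 pp; rewrite /c; case: eqP => [-> //|]; nia.
  by rewrite -expnM leq_pexp2l ?prime_gt0 //; lia.
apply: (@leq_trans (\prod_(p <- primes m) (c p * (p.-1 * p ^ (logn p m).-1) ^ 2))%N).
  rewrite big_seq [X in (_ <= X)%N]big_seq.
  by elim/big_ind2: _ => // a b a' b'; exact: leq_mul.
rewrite big_split /= leq_mul //.
  rewrite /c -big_mkcond /= big_const_seq iter_muln muln1.
  apply: (@leq_pexp2l 2 _ 1) => //.
  rewrite (@count_uniq_mem _ _ 2%N) ?primes_uniq //; exact: leq_b1.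
elim/big_ind2: _ => // a b a' b' h h'; by rewrite expnMn leq_mul.
Qed.

Lemma Phi_pred_bounded (n : nat) : (0 < n)%N ->
  forall m, Phi_pred n m -> (m <= 8 * n ^ 2)%N.
Proof.
move=> n0 m /= /andP[m0 /dvdn_leq h]; have {}h := h ltac:(lia).
by have := leq_totient_sqr m0; nia.
Qed.

(* For n = 0 every m > 0 satisfies Phi_pred, so the maximum needs 0 < n. *)
Definition Phi (n : nat) (n_gt0 : (0 < n)%N) : nat :=
  ex_maxn (Phi_pred_ex n) (Phi_pred_bounded n_gt0).

(* series harmonic n = 1 + 1/2 + ... + 1/n *)
Definition euler_gamma_seq (R : realType) : R ^nat := fun n => series harmonic n - ln n%:R.

Definition euler_gamma (R : realType) : R := limn (euler_gamma_seq R).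

Lemma is_cvg_euler_gamma_seq (R : realType) : cvgn (euler_gamma_seq R).
Proof.
suff /cvg_ex[l] : cvgn [sequence euler_gamma_seq R n.+1]_n.
  by rewrite cvg_shiftS => /cvgP.
apply: nonincreasing_is_cvgn.
  apply/nonincreasing_seqP => n.
  rewrite /= /euler_gamma_seq (seriesSr _ n.+1) /=.
  have h : ln (1 + - n.+2%:R^-1) <= - n.+2%:R^-1 :> R.
    by apply: le_ln1Dx; rewrite ltrN2 invf_lt1 ?ltr0n // ltr1n.
  have e : 1 + - n.+2%:R^-1 = n.+1%:R / n.+2%:R :> R.
    have n2 : n.+2%:R != 0 :> R by rewrite pnatr_eq0.
    by rewrite -[n.+2%:R in LHS]natr1 -natr1; field; rewrite -?natr1 in n2 *.
  rewrite e ln_div ?posrE ?ltr0n // in h.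
  move: h {e}; move: (ln _) (ln _) (_^-1) (series _ _) => a b c d; lra.
exists 0 => _ [n _ <-]; rewrite /= /euler_gamma_seq subr_ge0.
have le_step k : ln k.+1%:R <= series harmonic k :> R.
  elim: k => [|k IH]; first by rewrite ln1 /series /= big_geq.
  rewrite seriesSr /=.
  have h : ln (1 + k.+1%:R^-1) <= k.+1%:R^-1 :> R.
    by apply: le_ln1Dx; rewrite (@lt_trans _ _ 0) ?ltrN10 // invr_gt0 ltr0n.
  have e : 1 + k.+1%:R^-1 = k.+2%:R / k.+1%:R :> R.
    have k1 : k.+1%:R != 0 :> R by rewrite pnatr_eq0.
    by rewrite -[k.+2%:R]natr1; field.
  rewrite e ln_div ?posrE ?ltr0n // in h.
  move: h IH {e}; move: (ln _) (ln _) (_^-1) (series _ _) => a b c d; lra.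
apply: le_trans (le_step _) _.
by rewrite seriesSr lerDl harmonic_ge0.
Qed.

(* Main.v *)
From Stdlib Require Import BinNat.
Require Import Defs.
From mathcomp Require Import all_boot all_order all_algebra.
From mathcomp Require Import all_classical all_reals all_analysis.
From mathcomp Require Import zify ring lra.
Set Implicit Arguments. Unset Strict Implicit. Unset Printing Implicit Defensive.
Import Order.TTheory GRing.Theory Num.Theory.
Import numFieldNormedType.Exports.
Local Open Scope ring_scope.

(** If [totient m] divides [2 n], then [m <= 2 n * \prod_(p | m) p / (p - 1)].

    When [16] does not divide [n], at most four odd primes divide [m], and the
    product is at most that of 2, 3, 5, 7, 11, namely 77/16.

    When [16] divides [n], no sharp Mertens estimate is needed, because
    [\prod_(p | m) (p - 1) <= 2 n] limits the primes of [m] far more severely than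
    the 2-adic valuation.  Write [w p = ln (p / (p - 1))].  Since [w p / ln (p - 1)]
    decreases and crosses [1 / (N ln N)] at [N], a Lagrange-multiplier exchange gives
      [\sum_(p | m) w p <= \sum_(p <= N) w p
                           + (ln (2 n) - \sum_(p <= N) ln (p - 1)) / (N ln N)]
    for every [N].  Mertens' product is bounded, with the exact constant [gamma], by
      [\sum_(p <= N) w p <= ln (ln N) + gamma + (B N - ln N + 1 + 1/N) / ln N + 1/N]
    where [B N = \sum_(p <= N) ln p / (p - 1)], and Legendre's formula gives
    [B N <= ln N + theta N / N + O(1)]: the Chebyshev function [theta] cancels against
    the exchange term, so no prime-counting estimate remains.  Taking [N] close to
    [ln (2 n)] settles [t' >= 960]; for smaller [t'] the exchange inequality with
    [N = 8, 16, 64, 256] and explicit products over primes suffices. *)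

(** * Logarithms, factorials and Legendre's formula *)

Section LnBounds.
Variable R : realType.
Implicit Types (x y : R) (n : nat).

Lemma ln_le_subr1 x : 0 < x -> ln x <= x - 1.
Proof.
move=> x0; have h : -1 < x - 1 by lra.
by have := le_ln1Dx h; rewrite addrC subrK.
Qed.

Lemma ln_ge_subV x : 0 < x -> 1 - x^-1 <= ln x.
Proof.
move=> x0; have h : 0 < x^-1 by rewrite invr_gt0.
have := ln_le_subr1 h; rewrite lnV ?posrE //; lra.
Qed.

Lemma ln_sub_le x y : 0 < x -> 0 < y -> ln x - ln y <= (x - y) / y.
Proof.
move=> x0 y0; rewrite -ln_div ?posrE // mulrBl mulfV ?gt_eqF //.
by apply: ln_le_subr1; rewrite divr_gt0.
Qed.

Lemma ln_mono x y : 0 < x -> x <= y -> ln x <= ln y.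
Proof. by move=> x0 xy; rewrite ler_ln ?posrE //; apply: lt_le_trans xy. Qed.

Lemma prime_ge2 (p : nat) : prime p -> 2 <= p%:R :> R.
Proof. by move=> /prime_gt1; rewrite (ler_nat R 2). Qed.

Lemma ln_prime_gt0 (p : nat) : prime p -> 0 < ln p%:R :> R.
Proof. by move=> pp; apply: ln_gt0; have := prime_ge2 pp; lra. Qed.

Lemma ln_fact_ge n : (0 < n)%N -> n%:R * ln n%:R - n%:R <= ln n`!%:R :> R.
Proof.
elim: n => // -[_ _|n IH _]; first by rewrite factS fact0 muln1 ln1; lra.
have {}IH := IH isT.
rewrite factS natrM lnM ?posrE ?ltr0n ?fact_gt0 //.
have h : ln n.+2%:R - ln n.+1%:R <= (n.+2%:R - n.+1%:R) / n.+1%:R :> R.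
  by apply: ln_sub_le; rewrite ltr0n.
have n0 : 0 < n.+1%:R :> R by rewrite ltr0n.
rewrite -[in X in X / _]natr1 [n.+1%:R + 1]addrC addrK in h.
rewrite ler_pdivlMr // in h.
move: h IH; rewrite -[n.+2%:R]natr1.
by set a := ln n.+1%:R; set b := ln (_ + 1); lra.
Qed.

Lemma ln_fact_le n : (0 < n)%N ->
  ln n`!%:R <= n%:R * ln n%:R - n%:R + 1 + ln n%:R :> R.
Proof.
elim: n => // -[_ _|n IH _]; first by rewrite factS fact0 muln1 ln1; lra.
have {}IH := IH isT.
rewrite factS natrM lnM ?posrE ?ltr0n ?fact_gt0 //.
have h : ln n.+1%:R - ln n.+2%:R <= (n.+1%:R - n.+2%:R) / n.+2%:R :> R.
  by apply: ln_sub_le; rewrite ltr0n.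
have n0 : 0 < n.+2%:R :> R by rewrite ltr0n.
rewrite ler_pdivlMr // in h.
move: h IH; rewrite -[n.+2%:R]natr1.
by set a := ln n.+1%:R; set b := ln (_ + 1); lra.
Qed.

Lemma ln_prod (I : Type) (r : seq I) (P : pred I) (F : I -> R) :
  (forall i, P i -> 0 < F i) ->
  ln (\prod_(i <- r | P i) F i) = \sum_(i <- r | P i) ln (F i).
Proof.
move=> F0; suff [] : 0 < \prod_(i <- r | P i) F i /\
  ln (\prod_(i <- r | P i) F i) = \sum_(i <- r | P i) ln (F i) by [].
elim/big_rec2: _ => [|i x y Pi [y0 <-]]; first by rewrite ltr01 ln1.
by rewrite mulr_gt0 ?F0 // lnM ?posrE ?F0.
Qed.

Lemma ln_fact_primes n :
  ln n`!%:R = \sum_(0 <= p < n.+1 | prime p) (logn p n`!)%:R * ln p%:R :> R.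
Proof.
rewrite -{1}(partnT (fact_gt0 n)).
have -> : (n`!`_predT = \prod_(0 <= p < n.+1 | prime p) p ^ logn p n`!)%N.
  rewrite /partn.
  have sn : (n.+1 <= (n`!).+1)%N.
    by rewrite ltnS; case: n => // n; rewrite factS leq_pmulr // fact_gt0.
  rewrite [LHS](big_cat_nat (n := n.+1)) //= [X in (_ * X)%N]big1_seq ?muln1.
    rewrite [RHS]big_mkcond /=; apply: eq_bigr => p _.
    by case: ifP => // np; rewrite lognE np.
  move=> p; rewrite mem_index_iota => /andP[_ /andP[np _]].
  have [pp|/negbTE pp] := boolP (prime p); last by rewrite lognE pp.
  rewrite logn_fact // big1_seq ?expn0 // => k.
  rewrite mem_index_iota => /andP[_ /andP[k0 _]]; rewrite divn_small //.
  apply: leq_trans np _; rewrite -{1}(expn1 p) leq_pexp2l //; exact: prime_gt0.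
rewrite natr_prod ln_prod => [|p pp]; last by rewrite ltr0n expn_gt0 prime_gt0.
by apply: eq_bigr => p pp; rewrite natrX lnXn ?ltr0n ?prime_gt0 // mulr_natl.
Qed.

Lemma logn_fact_le p n : prime p -> (logn p n`!)%:R * (p%:R - 1) <= n%:R :> R.
Proof.
move=> pp; have p2 := prime_ge2 pp; rewrite logn_fact //.
(* Carrying the remainder [n / p ^ m] left after [m] terms of Legendre's formula makes the geometric
   bound inductive. *)
suff H m : (\sum_(1 <= k < m.+1) n %/ p ^ k)%:R * (p%:R - 1)
   + n%:R / p%:R ^+ m <= n%:R :> R.
  have := H n; apply: le_trans; rewrite lerDl divr_ge0 ?exprn_ge0 //; lra.
elim: m => [|m IH]; first by rewrite big_nil expr0 divr1 mul0r add0r.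
rewrite big_nat_recr //=; apply: le_trans IH.
rewrite natrD mulrDl -addrA lerD2l.
have pm : 0 < p%:R ^+ m.+1 :> R by rewrite exprn_gt0 //; lra.
have -> : n%:R / p%:R ^+ m = (p%:R - 1) * (n%:R / p%:R ^+ m.+1) + n%:R / p%:R ^+ m.+1 :> R.
  have p0 : p%:R != 0 :> R by rewrite gt_eqF //; lra.
  rewrite exprS; field; by rewrite p0 /= expf_neq0.
rewrite lerD2r mulrC ler_wpM2l ?subr_ge0 //; first lra.
rewrite ler_pdivlMr // -natrX -natrM ler_nat.
by rewrite leq_trunc_div.
Qed.

Definition sum_lnp_predp n : R := \sum_(0 <= p < n.+1 | prime p) ln p%:R / (p%:R - 1).

(** In [ln n!] each [ln p] has coefficient at most [n / (p - 1)], so a weak Stirling lower bound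
    passes to the sum. *)
Lemma sum_lnp_predp_ge n : (0 < n)%N -> ln n%:R - 1 <= sum_lnp_predp n.
Proof.
move=> n0; have n0' : 0 < n%:R :> R by rewrite ltr0n.
rewrite -(ler_pM2l n0'); have := ln_fact_ge n0.
rewrite mulrBr mulr1 => /le_trans; apply.
rewrite ln_fact_primes /sum_lnp_predp big_distrr /=; apply: ler_sum => p pp.
have p2 := prime_ge2 pp; rewrite mulrCA mulrC ler_wpM2l ?(ltW (ln_prime_gt0 pp)) //.
by rewrite ler_pdivlMr; [exact: logn_fact_le | lra].
Qed.

Definition theta n : R := \sum_(0 <= p < n.+1 | prime p) ln p%:R.

(** The exponent of [p] in [n!] is at least [n %/ p], hence more than [n / p - 1]; the losses of one
    per prime add up to [theta n]. *)
Lemma sum_lnp_div_le n : n%:R * (\sum_(0 <= p < n.+1 | prime p) ln p%:R / p%:R)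
  <= ln n`!%:R + theta n.
Proof.
rewrite ln_fact_primes -big_split big_distrr /=; apply: ler_sum => p pp.
have p2 := prime_ge2 pp; rewrite -[X in _ + X]mul1r -mulrDl mulrCA mulrC.
rewrite ler_wpM2r ?(ltW (ln_prime_gt0 pp)) // ler_pdivrMr; last lra.
rewrite natr1 -natrM ler_nat.
have h : (n %/ p <= logn p n`!)%N.
  rewrite logn_fact //; case: n => [|n]; first by rewrite div0n.
  by rewrite big_ltn // expn1 leq_addr.
by have := ltn_ceil n (prime_gt0 pp); nia.
Qed.

Definition sum_lnp_ppredp n : R :=
  \sum_(0 <= p < n.+1 | prime p) ln p%:R / (p%:R * (p%:R - 1)).

Lemma sum_lnp_predp_le n : (0 < n)%N ->
  sum_lnp_predp n <= sum_lnp_ppredp n + ln n%:R - 1 + (1 + ln n%:R + theta n) / n%:R.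
Proof.
move=> n0; have n0' : 0 < n%:R :> R by rewrite ltr0n.
have -> : sum_lnp_predp n = sum_lnp_ppredp n + \sum_(0 <= p < n.+1 | prime p) ln p%:R / p%:R.
  rewrite -big_split; apply: eq_bigr => p pp /=; have p2 := prime_ge2 pp.
  by field; rewrite !gt_eqF //; lra.
rewrite -!addrA lerD2l -(ler_pM2l n0').
apply: le_trans (sum_lnp_div_le n) _; have := ln_fact_le n0.
have -> : n%:R * (ln n%:R + (- 1 + (1 + (ln n%:R + theta n)) / n%:R)) =
  n%:R * ln n%:R - n%:R + 1 + ln n%:R + theta n by field; rewrite gt_eqF.
by rewrite lerD2r.
Qed.

End LnBounds.

(** * A finite Euler product inequality *)

(** Only primes strictly below [k] are sieved out, so [rough 0] holds of everything and passing to
    [k.+1] changes something only when [k] is prime. *)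
Definition rough (k n : nat) : bool :=
  all (fun q => prime q ==> ~~ (q %| n)%N) (iota 0 k).

Lemma roughS k n : rough k.+1 n = rough k n && (prime k ==> ~~ (k %| n)%N).
Proof. by rewrite /rough -{1}(addn1 k) iotaD all_cat /= andbT. Qed.

Lemma rough_mull k n : prime k -> rough k n -> rough k (k * n).
Proof.
move=> kp /allP rn; apply/allP => q qk; have := rn q qk.
case: (boolP (prime q)) => //= qp /negbTE qn.
rewrite Euclid_dvdM // qn orbF dvdn_prime2 //.
by move: qk; rewrite mem_iota; lia.
Qed.

Section EulerProduct.
Variables (R : realType) (e : R).
Hypothesis e0 : 0 < e.

(** The general term [n ^ - (1 + e)] of the zeta series. *)
Definition npow (n : nat) : R := expR (- ((1 + e) * ln n%:R)).

Lemma npow_ge0 n : 0 <= npow n. Proof. exact: expR_ge0. Qed.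

Lemma npowM m n : (0 < m)%N -> (0 < n)%N -> npow (m * n) = npow m * npow n.
Proof.
move=> m0 n0; rewrite /npow natrM lnM ?posrE ?ltr0n // -expRD; congr expR; ring.
Qed.

Lemma npowE n : (0 < n)%N -> npow n = expR (- (e * ln n%:R)) / n%:R.
Proof.
move=> n0; rewrite /npow mulrDl mul1r opprD expRD mulrC; congr (_ * _).
by rewrite expRN lnK ?posrE ?ltr0n.
Qed.

Lemma npow1 : npow 1 = 1. Proof. by rewrite /npow ln1 mulr0 oppr0 expR0. Qed.

Lemma npow_lt1 n : (1 < n)%N -> npow n < 1.
Proof.
move=> n1; rewrite /npow expR_lt1 oppr_lt0 mulr_gt0 ?ln_gt0 ?ltr1n //.
by rewrite addr_gt0.
Qed.

Lemma sum_npow_le n : \sum_(1 <= k < n.+1) npow k <= 1 + e^-1.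
Proof.
case: n => [|n]; first by rewrite big_nil addr_ge0 ?invr_ge0 ?ltW.
(* Discrete integral test: the subtracted term is the integral of the tail, and [1 + x <= expR x]
   closes the induction. *)
have H : \sum_(1 <= k < n.+2) npow k <= 1 + e^-1 - e^-1 * expR (- (e * ln n.+1%:R)).
  elim: n => [|n IH].
    by rewrite big_nat1 npow1 ln1 mulr0 oppr0 expR0 mulr1; lra.
  rewrite big_nat_recr //=; apply: le_trans (lerD IH (lexx _)) _.
  set a := expR _; set b := expR (- (e * ln n.+2%:R)).
  have n2 : 0 < n.+2%:R :> R by rewrite ltr0n.
  rewrite npowE // -/b.
  suff h : b * (1 + e / n.+2%:R) <= a.
    have : e^-1 * (b * (1 + e / n.+2%:R)) <= e^-1 * a by rewrite ler_pM2l ?invr_gt0.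
    have -> : e^-1 * (b * (1 + e / n.+2%:R)) = e^-1 * b + b / n.+2%:R.
      by field; rewrite !gt_eqF.
    by move: (e^-1 * b) (e^-1 * a) (b / _) => x y z; lra.
  have -> : a = b * expR (e * (ln n.+2%:R - ln n.+1%:R)).
    by rewrite -expRD; congr expR; ring.
  rewrite ler_wpM2l ?expR_ge0 //; apply: le_trans (expR_ge1Dx _).
  rewrite lerD2l ler_pM2l //.
  have h : ln n.+1%:R - ln n.+2%:R <= (n.+1%:R - n.+2%:R) / n.+2%:R :> R.
    by apply: ln_sub_le; rewrite ltr0n.
  move: h; have -> : n.+1%:R - n.+2%:R = -1 :> R by rewrite -[n.+2%:R]natr1; ring.
  by rewrite mulN1r; move: (n.+2%:R^-1) (ln n.+1%:R) (ln n.+2%:R) => x y z; lra.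
apply: le_trans H _; rewrite gerBl mulr_ge0 ?expR_ge0 // invr_ge0 ltW //.
Qed.

Definition rough_sum (k n : nat) : R := \sum_(1 <= i < n.+1 | rough k i) npow i.

Lemma rough_sum_homo k m n : (m <= n)%N -> rough_sum k m <= rough_sum k n.
Proof.
move=> mn; rewrite /rough_sum [leRHS](big_cat_nat (n := m.+1)) //= lerDl.
by apply: sumr_ge0 => i _; exact: npow_ge0.
Qed.

Lemma rough_sum_le k n : rough_sum k n <= 1 + e^-1.
Proof.
apply: le_trans (sum_npow_le n); rewrite /rough_sum big_mkcond /=.
by apply: ler_sum => i _; case: ifP => // _; exact: npow_ge0.
Qed.

(** The [k]-rough multiples of [k] up to [k * n] include [k * i] for every [k]-rough [i <= n], and
    [npow] is multiplicative. *)
Lemma rough_sum_prime k n : prime k ->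
  rough_sum k.+1 (k * n) + npow k * rough_sum k n <= rough_sum k (k * n).
Proof.
move=> kp; have k0 := prime_gt0 kp.
have -> : rough_sum k (k * n) = rough_sum k.+1 (k * n) +
    \sum_(1 <= i < (k * n).+1 | rough k i && (k %| i)%N) npow i.
  rewrite /rough_sum (bigID (fun i => k %| i)%N) /= addrC; congr (_ + _).
  by apply: eq_bigl => i; rewrite roughS kp.
rewrite lerD2l; elim: n => [|n IH].
  by rewrite /rough_sum muln0 !big_nil mulr0.
rewrite [leRHS](big_cat_nat (n := (k * n).+1)) //=; last by rewrite ltnS leq_mul2l leqnSn orbT.
have -> : rough_sum k n.+1 = rough_sum k n + (if rough k n.+1 then npow n.+1 else 0).
  by rewrite /rough_sum big_mkcond big_nat_recr //= -big_mkcond.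
rewrite mulrDr lerD //.
rewrite mulnS addnC -addSn.
case: k k0 kp {IH} => // k _ kp.
rewrite addnS big_mkcond big_nat_recr /=; last by rewrite leq_addr.
rewrite -[leLHS]add0r lerD //.
  by apply: sumr_ge0 => i _; case: ifP => // _; exact: npow_ge0.
case: ifP => [rn|_]; last by rewrite mulr0; case: ifP => // _; exact: npow_ge0.
have -> : ((k.+1 * n).+1 + k)%N = (k.+1 * n.+1)%N by lia.
by rewrite rough_mull //= dvdn_mulr // -npowM.
Qed.

Lemma rough_sum_ge1 k : 1 <= rough_sum k 1.
Proof.
rewrite /rough_sum big_mkcond big_nat1.
have -> : rough k 1 by apply/allP => q _; apply/implyP => qp; rewrite dvdn1; case: eqP qp => // ->.
by rewrite npow1.
Qed.

Let C k := sup (range (rough_sum k)).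

Lemma rough_sum_has_sup k : has_sup (range (rough_sum k)).
Proof.
by split; [exists (rough_sum k 0%N); exists 0%N | exists (1 + e^-1) => _ [n _ <-]; exact: rough_sum_le].
Qed.

Let le_C k n : rough_sum k n <= C k.
Proof. by apply: ub_le_sup; [case: (rough_sum_has_sup k) | exists n]. Qed.

Let C_S k : C k.+1 <= if prime k then (1 - npow k) * C k else C k.
Proof.
apply: ge_sup; first by exists (rough_sum k.+1 0%N); exists 0%N.
move=> _ [n0 _ <-]; case: ifP => kp; last first.
  apply: le_trans (le_C _ n0); rewrite /rough_sum le_eqVlt; apply/orP; left; apply/eqP.
  by apply: eq_bigl => i; rewrite roughS kp andbT.
apply/ler_addgt0Pr => d d0.
have f0 : 0 < npow k by exact: expR_gt0.
have [_ [n1 _ <-] hn] := sup_adherent (divr_gt0 d0 f0) (rough_sum_has_sup k).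
pose n := maxn n0 n1.
have h1 : rough_sum k.+1 n0 <= rough_sum k.+1 (k * n).
  by apply: rough_sum_homo; rewrite /n; have := prime_gt0 kp; nia.
have h2 : rough_sum k n1 <= rough_sum k n by apply: rough_sum_homo; rewrite /n; lia.
have h3 := rough_sum_prime n kp; have h4 := le_C k (k * n)%N.
have h5 : npow k * (C k - d / npow k) <= npow k * rough_sum k n.
  by rewrite ler_pM2l //; apply: le_trans h2; exact: ltW.
have h6 : npow k * (d / npow k) = d by field; rewrite gt_eqF.
by rewrite mulrBr h6 in h5; lra.
Qed.

(* The [k]-rough numbers always contain 1, and each sieving step multiplies the full
   rough sum by [1 - npow p], so the sieved zeta sum stays at least 1. *)
Lemma euler_product n :
  1 <= (\prod_(0 <= p < n | prime p) (1 - npow p)) * (1 + e^-1).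
Proof.
have H : C n <= (\prod_(0 <= p < n | prime p) (1 - npow p)) * C 0%N.
  elim: n => [|n IH]; first by rewrite big_nil mul1r.
  rewrite big_mkcond big_nat_recr //= -big_mkcond /=.
  apply: le_trans (C_S n) _; case: ifP => np; last by rewrite mulr1.
  rewrite mulrAC mulrC ler_wpM2r // subr_ge0 ltW // npow_lt1 // prime_gt1 //.
apply: le_trans (le_trans (rough_sum_ge1 n) (le_C n 1%N)) (le_trans H _).
rewrite ler_wpM2l //.
  by apply: prodr_ge0 => p pp; rewrite subr_ge0 ltW // npow_lt1 // prime_gt1.
by apply: ge_sup => [|_ [m _ <-]]; [exists (rough_sum 0 0%N); exists 0%N | exact: rough_sum_le].
Qed.

Lemma euler_sum n :
  \sum_(0 <= p < n | prime p) - ln (1 - npow p) <= ln (1 + e^-1).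
Proof.
have p0 p : prime p -> 0 < 1 - npow p.
  by move=> pp; rewrite subr_gt0 npow_lt1 // prime_gt1.
have e1 : 0 < 1 + e^-1 by rewrite addr_gt0 ?invr_gt0.
have P0 : 0 < \prod_(0 <= p < n | prime p) (1 - npow p) by apply: prodr_gt0 => p /p0.
rewrite sumrN -ln_prod //.
have := ln_mono ltr01 (euler_product n); rewrite ln1 lnM ?posrE //; lra.
Qed.
End EulerProduct.

(** * Mertens' third theorem, upper bound *)

Section Mertens.
Variable R : realType.

(** The truncated series plus [ln (1 - x)] plus [c * x] vanishes at 0 and has derivative
    [c - x ^ J / (1 - x)], which keeps one sign on [[0, q]] for [c = 0] and for
    [c = q ^ J / (1 - q)]. *)
Lemma neg_ln1B_bounds (q : R) (J : nat) : 0 < q < 1 ->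
  \sum_(i < J) q ^+ i.+1 / i.+1%:R <= - ln (1 - q) <=
  \sum_(i < J) q ^+ i.+1 / i.+1%:R + q * (q ^+ J / (1 - q)).
Proof.
move=> /andP[q0 q1].
pose p : {poly R} := \sum_(i < J) i.+1%:R^-1 *: 'X^(i.+1).
pose f (c : R) : R -> R := horner (p + c *: 'X) + ((@ln R) \o horner (1 - 'X)).
have fE c x : f c x = \sum_(i < J) x ^+ i.+1 / i.+1%:R + ln (1 - x) + c * x.
  rewrite /f !fctE /p !hornerE horner_sum addrAC; congr (_ + _ + _).
  by apply: eq_bigr => i _; rewrite !hornerE mulrC.
have D (c x : R) : x < 1 -> is_derive x 1 (f c) (c - x ^+ J / (1 - x)).
  move=> x1; have x1' : 0 < (1 - 'X).[x] by rewrite !hornerE; lra.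
  have ? := is_derive1_ln x1'.
  rewrite /f; apply: is_derive_eq.
  rewrite !poly.derivE raddf_sum /= !hornerE horner_sum.
  rewrite (eq_bigr (fun i : 'I_J => x ^+ i)); last first.
    move=> i _; rewrite !poly.derivE hornerZ hornerMn hornerXn.
    by rewrite -[X in _ * X]mulr_natl mulrA mulVf ?pnatr_eq0 // mul1r.
  have x1n : 1 - x != 0 by rewrite subr_eq0 eq_sym lt_eqF.
  have -> : x ^+ J = 1 + (x - 1) * \sum_(i < J) x ^+ i by rewrite -subrX1; ring.
  by move: (\sum_(i < J) _) => S; field.
have cont c : {within `[0, q], continuous (f c)}%classic.
  apply: derivable_within_continuous => x; rewrite in_itv /= => /andP[_ xq].
  have /(D c) : x < 1 by lra.
  by move=> ?; exact: ex_derive.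
have mono c : (forall x, 0 < x < q -> 0 <= c - x ^+ J / (1 - x)) -> f c 0 <= f c q.
  move=> H; apply: (@ger0_derive1_ndecr _ (f c) 0 q) => // [x|x|].
  - rewrite in_itv /= => /andP[_ xq]; have /(D c) ? : x < 1 by lra.
    exact: ex_derive.
  - rewrite in_itv /= => x0q; have x1 : x < 1 by lra.
    by have ? := D c _ x1; rewrite derive1E derive_val; exact: H.
  - exact: ltW.
have mono' c : (forall x, 0 < x < q -> c - x ^+ J / (1 - x) <= 0) -> f c q <= f c 0.
  move=> H; apply: (@ler0_derive1_nincr _ (f c) 0 q) => // [x|x|].
  - rewrite in_itv /= => /andP[_ xq]; have /(D c) ? : x < 1 by lra.
    exact: ex_derive.
  - rewrite in_itv /= => x0q; have x1 : x < 1 by lra.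
    by have ? := D c _ x1; rewrite derive1E derive_val; exact: H.
  - exact: ltW.
have f0 c : f c 0 = 0.
  rewrite fE subr0 ln1 mulr0 !addr0 big1 // => i _.
  by rewrite expr0n mul0r.
apply/andP; split.
  have := mono' 0; rewrite f0 fE mul0r addr0 => H.
  suff : \sum_(i < J) q ^+ i.+1 / i.+1%:R + ln (1 - q) <= 0 by lra.
  apply: H => x /andP[x0 xq]; rewrite sub0r oppr_le0 divr_ge0 ?exprn_ge0 ?ltW //.
  by lra.
have := mono (q ^+ J / (1 - q)); rewrite f0 fE [q * _]mulrC => H.
suff : 0 <= \sum_(i < J) q ^+ i.+1 / i.+1%:R + ln (1 - q) + q ^+ J / (1 - q) * q by lra.
apply: H => x /andP[x0 xq]; rewrite subr_ge0 ler_pM ?exprn_ge0 ?(ltW x0) //.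
- by rewrite invr_ge0; lra.
- by rewrite lerXn2r ?nnegrE ?ltW.
- by rewrite lef_pV2 ?posrE; lra.
Qed.

(* Abel summation against a step function: only a lower bound on the partial sums [s]
   is needed because the weights [g] decrease. *)
Lemma abel_lower (s g : nat -> R) (d c : R) (J : nat) : s 0%N = 0 ->
  (forall k, k%:R * d - c <= s k) -> (forall k, g k.+1 <= g k) ->
  (forall k, 0 <= g k) ->
  d * (\sum_(k < J) g k.+1) - c * g 1%N <= \sum_(k < J) (s k.+1 - s k) * g k.+1.
Proof.
move=> s0 hs gd g0.
have c0 : 0 <= c by have := hs 0%N; rewrite s0; lra.
case: J => [|J]; first by rewrite !big_ord0; have := g0 1%N; nra.
(* The boundary term of the summation by parts is kept, so each step uses only the lower bound on
   [s] and the decrease of [g]. *)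
suff H : d * (\sum_(k < J.+1) g k.+1) + (s J.+1 - J.+1%:R * d) * g J.+1
    - c * (g 1%N - g J.+1) <= \sum_(k < J.+1) (s k.+1 - s k) * g k.+1.
  have h1 : 0 <= (s J.+1 - J.+1%:R * d + c) * g J.+1.
    by apply: mulr_ge0 => //; have := hs J.+1; lra.
  by apply: le_trans H; move: h1; rewrite !mulrDl !mulrBr mulNr; lra.
elim: J => [|J IH].
  by rewrite !big_ord_recr !big_ord0 /= s0; lra.
rewrite big_ord_recr [leRHS]big_ord_recr /=.
move: IH; set S1 := \sum_(k < _) _; set S2 := \sum_(k < _) _ => IH.
have h1 : 0 <= (s J.+1 - J.+1%:R * d + c) * (g J.+1 - g J.+2).
  by apply: mulr_ge0; [have := hs J.+1; lra | rewrite subr_ge0].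
move: IH h1; rewrite -[J.+2%:R]natr1.
by move: (J.+1%:R) (g J.+1) (g J.+2) (g 1%N) (s J.+1) (s J.+2) => a b b' b'' x y; nra.
Qed.
End Mertens.

Section MertensBound.
Variables (R : realType) (N : nat).
Hypothesis N2 : (2 <= N)%N.

Let L : R := ln N%:R.
(** The deficit allowed in [s_ge]: 1 is the loss in [sum_lnp_predp_ge], and [1 / N] pays for
    rounding the lattice points to integers. *)
Let c : R := sum_lnp_predp R N - L + 1 + N%:R^-1.

Let N0 : 0 < N%:R :> R. Proof. by rewrite ltr0n; apply: leq_trans N2. Qed.
Let L0 : 0 < L. Proof. by apply: ln_gt0; rewrite ltr1n. Qed.

Lemma sum_telescope_inv (n : nat) : (N <= n)%N ->
  \sum_(N.+1 <= p < n.+1 | prime p) (p%:R * (p%:R - 1))^-1 <= N%:R^-1 - n%:R^-1 :> R.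
Proof.
elim: n => [|n IH]; first by move: N2; case: (N).
rewrite leq_eqVlt => /orP[/eqP <-|]; first by rewrite big_geq // subrr.
rewrite ltnS => Nn; have {}IH := IH Nn.
have n0 : 0 < n%:R :> R by rewrite ltr0n; apply: leq_trans Nn; apply: leq_trans N2.
rewrite big_mkcond big_nat_recr //= -big_mkcond /=.
apply: le_trans (lerD IH (lexx _)) _.
have h : (n.+1%:R * (n.+1%:R - 1))^-1 = n%:R^-1 - n.+1%:R^-1 :> R.
  by rewrite -natr1; field; rewrite !gt_eqF //; lra.
have : 0 <= n%:R^-1 - n.+1%:R^-1 :> R.
  by rewrite -h invr_ge0 mulr_ge0 // -natr1; lra.
rewrite h; move: (n%:R^-1) (n.+1%:R^-1) (N%:R^-1) => x y z.
by case: ifP => _; lra.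
Qed.

(* The primes above [N] are compared with the lattice [k * d], [d = ln N / K], on the
   logarithmic scale: there the damped sum is [\sum q^k / k = - ln (1 - q)] and the
   truncated one is a harmonic number, which is where Euler's constant comes from. *)
Section Fixed.
Variables (e : R) (K : nat).
Hypotheses (e0 : 0 < e) (K0 : (0 < K)%N).

Let d := L / K%:R.
Let K0' : 0 < K%:R :> R. Proof. by rewrite ltr0n. Qed.
Let d0 : 0 < d. Proof. exact: divr_gt0. Qed.
Let u k : R := (K + k)%:R * d.
Let u_S k : u k.+1 = u k + d. Proof. by rewrite /u addnS -natr1; ring. Qed.
Let u_0 : u 0%N = L. Proof. by rewrite /u addn0 /d; field; rewrite gt_eqF. Qed.
Let u_homo k : u 0%N <= u k.
Proof. by rewrite ler_pM2r // ler_nat addn0 leq_addr. Qed.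
Let u_gt0 k : 0 < u k.
Proof. by apply: lt_le_trans (u_homo k); rewrite u_0. Qed.
Let Y k := Num.truncn (expR (u k)).
Let Y0 : Y 0%N = N. Proof. by rewrite /Y u_0 lnK ?posrE // natrK. Qed.
Let Y_S k : (Y k <= Y k.+1)%N.
Proof. by apply: le_truncn; rewrite ler_expR u_S lerDl ltW. Qed.
Let Y_ge k : (N <= Y k)%N.
Proof. by elim: k => [|k IH]; [rewrite Y0 | apply: leq_trans (Y_S k)]. Qed.

Let s k := sum_lnp_predp R (Y k) - sum_lnp_predp R N.

Let s_ge k : k%:R * d - c <= s k.
Proof.
have Yk0 : (0 < Y k)%N by apply: leq_trans (Y_ge k); apply: leq_trans N2.
have Yk0' : 0 < (Y k)%:R :> R by rewrite ltr0n.
have h1 := sum_lnp_predp_ge R Yk0.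
have h2 : u k <= ln (Y k).+1%:R.
  by rewrite -[u k]expRK ln_mono ?expR_gt0 // ltW // truncnS_gt.
have h3 : ln (Y k).+1%:R - ln (Y k)%:R <= ((Y k).+1%:R - (Y k)%:R) / (Y k)%:R :> R.
  by apply: ln_sub_le; rewrite ?ltr0n.
rewrite -[in X in X / _]natr1 addrAC subrr add0r mul1r in h3.
have h4 : (Y k)%:R^-1 <= N%:R^-1 :> R by rewrite lef_pV2 ?posrE // ler_nat.
have h5 : u k = L + k%:R * d by rewrite /u natrD mulrDl -u_0 /u addn0.
rewrite /s /c; rewrite h5 in h2.
move: h1 h2 h3 h4; move: (k%:R * d) (ln (Y k)%:R) (ln (Y k).+1%:R) ((Y k)%:R^-1) (N%:R^-1).
by move=> a1 a2 a3 a4 a5; lra.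
Qed.

Let g k := expR (- (e * u k)) / u k.

Let g_ge0 k : 0 <= g k. Proof. by rewrite divr_ge0 ?expR_ge0 ?ltW. Qed.

Let g_mono x y : 0 < x -> x <= y -> expR (- (e * y)) / y <= expR (- (e * x)) / x.
Proof.
move=> x0 xy; have y0 := lt_le_trans x0 xy.
rewrite ler_pM ?expR_ge0 ?invr_ge0 ?(ltW y0) //.
  by rewrite ler_expR lerN2 ler_pM2l.
by rewrite lef_pV2 ?posrE.
Qed.

Let g_S k : g k.+1 <= g k.
Proof. by apply: g_mono => //; rewrite u_S lerDl ltW. Qed.

Let tail J := \sum_(N.+1 <= p < (Y J).+1 | prime p) expR (- (e * ln p%:R)) / (p%:R - 1).

(** A prime [p] with [Y k < p <= Y k.+1] has [ln p <= u k.+1], so its damped weight is at least the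
    step value [g k.+1]. *)
Let tail_ge J : \sum_(k < J) (s k.+1 - s k) * g k.+1 <= tail J.
Proof.
elim: J => [|J IH]; first by rewrite big_ord0 /tail Y0 big_geq.
rewrite big_ord_recr /=.
have -> : tail J.+1 = tail J +
   \sum_((Y J).+1 <= p < (Y J.+1).+1 | prime p) expR (- (e * ln p%:R)) / (p%:R - 1).
  by rewrite /tail (big_cat_nat (n := (Y J).+1)) //= ltnS.
apply: lerD => //.
have -> : s J.+1 - s J = \sum_((Y J).+1 <= p < (Y J.+1).+1 | prime p) ln p%:R / (p%:R - 1).
  rewrite /s /sum_lnp_predp [X in X - _ - _](big_cat_nat (n := (Y J).+1)) //= ?ltnS //.
  by ring.
rewrite big_distrl /= big_seq_cond [leRHS]big_seq_cond; apply: ler_sum => p.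
rewrite mem_index_iota => /andP[/andP[_ pY] pp].
have lp := ln_prime_gt0 R pp; have p2 := prime_ge2 R pp.
have -> : expR (- (e * ln p%:R)) / (p%:R - 1) =
  ln p%:R / (p%:R - 1) * (expR (- (e * ln p%:R)) / ln p%:R).
  by field; rewrite !gt_eqF //; lra.
rewrite ler_wpM2l //; first by rewrite divr_ge0 ?(ltW lp) //; lra.
rewrite /g; apply: g_mono => //; rewrite -[u J.+1]expRK ln_mono //; first lra.
by rewrite -truncn_ge_nat ?expR_ge0.
Qed.

Let q := expR (- (e * d)).
Let q01 : 0 < q < 1.
Proof. by rewrite expR_gt0 expR_lt1 oppr_lt0 mulr_gt0. Qed.

(** Because the lattice points are integer multiples of [d], the step function yields exactly the
    terms of the series of [- ln (1 - q)]. *)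
Let dg k : d * g k.+1 = q ^+ (K + k).+1 / (K + k).+1%:R.
Proof.
have E : expR (- (e * u k.+1)) = q ^+ (K + k).+1.
  by rewrite /q -expRM_natl /u addnS; congr expR; ring.
have Kk : (K + k).+1%:R != 0 :> R by rewrite pnatr_eq0.
have dn : d != 0 by rewrite gt_eqF.
by rewrite /g E /u addnS; move: (_.+1%:R) (q ^+ _) Kk => z x Kk; field; rewrite dn Kk.
Qed.

Let head := \sum_(0 <= p < N.+1 | prime p) - ln (1 - npow e p).

(** The primes above [N] use up at least [tail J - 1 / N] of the total allowed by [euler_sum], and
    Abel summation bounds [tail J] below; [g 1 <= 1 / L] gives the term [c / L]. *)
Let head_le J : head <= ln (1 + e^-1) - \sum_(k < J) q ^+ (K + k).+1 / (K + k).+1%:R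
   + c / L + N%:R^-1.
Proof.
have h1 := abel_lower J (_ : s 0%N = 0) s_ge g_S g_ge0.
have {}h1 := le_trans (h1 ltac:(by rewrite /s Y0 subrr)) (tail_ge J).
have dgE : d * (\sum_(k < J) g k.+1) = \sum_(k < J) q ^+ (K + k).+1 / (K + k).+1%:R.
  by rewrite big_distrr /=; apply: eq_bigr => k _; exact: dg.
rewrite dgE in h1.
have c0 : 0 <= c by have := s_ge 0%N; rewrite /s Y0 subrr; lra.
have h2 : c * g 1%N <= c / L.
  rewrite ler_wpM2l // /g -[leRHS]mul1r ler_pM ?expR_ge0 ?invr_ge0 ?(ltW (u_gt0 _)) //.
    by rewrite expR_le1 oppr_le0 mulr_ge0 // ltW.
  by rewrite lef_pV2 ?posrE // -u_0 u_homo.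
have h3 : tail J <= \sum_(N.+1 <= p < (Y J).+1 | prime p) npow e p + N%:R^-1.
  have := sum_telescope_inv (Y_ge J) => h.
  have y0 : 0 <= (Y J)%:R^-1 :> R by rewrite invr_ge0.
  suff : tail J <= \sum_(N.+1 <= p < (Y J).+1 | prime p) npow e p +
     \sum_(N.+1 <= p < (Y J).+1 | prime p) (p%:R * (p%:R - 1))^-1.
    by move: h y0; move: (\sum_(_ <= p < _ | _) _ ^-1) (_^-1) (N%:R^-1) => x y z; lra.
  rewrite -big_split; apply: ler_sum => p pp /=; have p2 := prime_ge2 R pp.
  rewrite npowE ?prime_gt0 //.
  have x1 : expR (- (e * ln p%:R)) <= 1.
    by rewrite expR_le1 oppr_le0 mulr_ge0 ?ltW // ln_prime_gt0.
  have x0 := expR_ge0 (- (e * ln p%:R)); move: x1 x0.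
  move: (expR _) => x x1 x0; rewrite -subr_ge0.
  have -> : x / p%:R + (p%:R * (p%:R - 1))^-1 - x / (p%:R - 1) =
     (1 - x) / (p%:R * (p%:R - 1)) by field; rewrite !gt_eqF //; lra.
  by rewrite divr_ge0 ?mulr_ge0 //; lra.
have h4 := euler_sum e0 (Y J).+1.
rewrite (big_cat_nat (n := N.+1)) //= ?ltnS // -/head in h4.
have h5 : \sum_(N.+1 <= p < (Y J).+1 | prime p) npow e p <=
   \sum_(N.+1 <= p < (Y J).+1 | prime p) - ln (1 - npow e p).
  apply: ler_sum => p pp.
  have := npow_lt1 e0 (prime_gt1 pp) => x1.
  have /ln_le_subr1 : 0 < 1 - npow e p by lra.
  by lra.
by lra.
Qed.

(** As [J] grows, the series beyond its first [K] terms tends to [- ln (1 - q) - S K]. With [S K] at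
    most the harmonic sum and [1 - q <= e * d = e * L / K], the harmonic sum minus [ln K]
    remains. *)
Let head_le2 : head <= ln (1 + e) + ln L + euler_gamma_seq R K + c / L + N%:R^-1.
Proof.
have [q0 q1] := andP q01.
pose S n := \sum_(i < n) q ^+ i.+1 / i.+1%:R.
have SH : S K <= series harmonic K.
  rewrite /S /series /= big_mkord; apply: ler_sum => i _.
  by rewrite -[leRHS]mul1r ler_wpM2r ?invr_ge0 // exprn_ile1 // ltW.
have Ssplit J : \sum_(k < J) q ^+ (K + k).+1 / (K + k).+1%:R = S (K + J)%N - S K.
  by rewrite /S big_split_ord /= addrAC subrr add0r.
have lnq : - ln (e * d) <= - ln (1 - q).
  rewrite lerN2 ln_mono ?subr_gt0 // lerBlDr addrC -lerBlDr.
  by have := expR_ge1Dx (- (e * d)); rewrite -/q; lra.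
have lnE : ln (1 + e^-1) + ln (e * d) = ln (1 + e) + ln L - ln K%:R.
  have e1 : 0 < 1 + e^-1 by rewrite addr_gt0 ?invr_gt0.
  rewrite -lnM ?posrE ?(mulr_gt0 e0 d0) //.
  have -> : (1 + e^-1) * (e * d) = (1 + e) * (L / K%:R).
    by rewrite /d; field; rewrite !gt_eqF.
  by rewrite lnM ?posrE ?divr_gt0 ?addr_gt0 // ln_div ?posrE // addrA.
suff H r : 0 < r -> head <= ln (1 + e^-1) - (- ln (1 - q) - S K) + c / L + N%:R^-1 + r.
  have := (introT (ler_addgt0Pr _ _) H).
    rewrite /euler_gamma_seq.
  by move: SH lnq lnE; move: (c / L) (N%:R^-1) => x y; lra.
move=> r0.
have [J hJ] : exists J, q * (q ^+ (K + J) / (1 - q)) <= r.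
  have q1' : 0 < (1 - q) * r / q by rewrite divr_gt0 ?mulr_gt0 // subr_gt0.
  have : \forall n \near \oo%classic, q ^+ n < (1 - q) * r / q.
    have := @cvg_expr R q; rewrite ger0_norm ?(ltW q0) // => /(_ q1).
    by move/cvgr_lt; apply.
  move=> [n _ hn]; exists n; have := hn (K + n)%N (leq_addl _ _).
  rewrite /= ltr_pdivlMr // mulrC [_ * r]mulrC => /ltW h.
  by rewrite mulrA ler_pdivrMr // subr_gt0.
have h1 := head_le J; have /andP[_ h2] := neg_ln1B_bounds (K + J) q01.
rewrite Ssplit in h1; rewrite -/(S _) in h2.
by move: h1 h2; move: (c / L) (N%:R^-1) => x y; lra.
Qed.

Lemma mertens_aux :
  \sum_(0 <= p < N.+1 | prime p) - ln (1 - npow e p) <=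
  ln (1 + e) + ln L + euler_gamma_seq R K + c / L + N%:R^-1.
Proof. exact: head_le2. Qed.
End Fixed.

Definition mertens_sum : R := \sum_(0 <= p < N.+1 | prime p) ln (p%:R / (p%:R - 1)).

(** First [K] tends to infinity, which produces [euler_gamma]; then the damping [e] is made
    small. *)
Lemma mertens_upper : mertens_sum <= ln L + euler_gamma R + c / L + N%:R^-1.
Proof.
apply/ler_addgt0Pr => r r0.
have B0 : 0 <= sum_lnp_predp R N.
  apply: sumr_ge0 => p pp; have p2 := prime_ge2 R pp.
  by rewrite divr_ge0 ?ltW ?ln_prime_gt0 //; lra.
(* Removing the damping costs at most [e * sum_lnp_predp R N], and [ln (1 + e) <= e]; the two costs
   add up to [r]. *)
pose e := r / (1 + sum_lnp_predp R N).
have e0 : 0 < e by rewrite divr_gt0 //; lra.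
have eE : e * (1 + sum_lnp_predp R N) = r by rewrite /e divfK // gt_eqF //; lra.
have h1 : \sum_(0 <= p < N.+1 | prime p) - ln (1 - npow e p) <=
  ln (1 + e) + ln L + euler_gamma R + c / L + N%:R^-1.
  set X := \sum_(_ <= p < _ | _) _.
  suff : X - (ln (1 + e) + ln L + c / L + N%:R^-1) <= euler_gamma R.
    by move: (c / L) (N%:R^-1) => x y; lra.
  apply: limr_ge; first exact: is_cvg_euler_gamma_seq.
  exists 1%N => // K K0; have := mertens_aux e0 K0.
  by rewrite -/X /=; move: (c / L) (N%:R^-1) => x y; lra.
have h2 : mertens_sum <= \sum_(0 <= p < N.+1 | prime p) - ln (1 - npow e p) + e * sum_lnp_predp R N.
  rewrite /mertens_sum /sum_lnp_predp big_distrr -big_split /=; apply: ler_sum => p pp.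
  have p2 := prime_ge2 R pp; have lp := ln_prime_gt0 R pp.
  have x1 := npow_lt1 e0 (prime_gt1 pp).
  have pp0 : 0 < p%:R / (p%:R - 1) :> R by rewrite divr_gt0; lra.
  have b1 := expR_ge1Dx (- (e * ln p%:R)).
  suff : ln (p%:R / (p%:R - 1)) + ln (1 - npow e p) <= e * (ln p%:R / (p%:R - 1)) by lra.
  rewrite -lnM ?posrE ?subr_gt0 //.
  apply: le_trans (ln_le_subr1 _) _; first by rewrite mulr_gt0 // subr_gt0.
  rewrite npowE ?prime_gt0 //; move: b1; move: (expR _) => b b1.
  have -> : p%:R / (p%:R - 1) * (1 - b / p%:R) - 1 = (1 - b) / (p%:R - 1).
    by field; rewrite !gt_eqF //; lra.
  by rewrite mulrA ler_pM2r ?invr_gt0; lra.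
have h3 : ln (1 + e) <= e by apply: le_ln1Dx; lra.
rewrite mulrDr mulr1 in eE.
by move: h1 h2 h3 eE; move: (c / L) (N%:R^-1) => x y; lra.
Qed.
End MertensBound.

(** * The exchange argument *)

Section TotientRatio.
Variable R : realType.

(** Common terms cancel; what is left of [s] lies above [N] and contributes nonpositively, what is
    left on the right is nonnegative. *)
Lemma sum_exchange (P : pred nat) (F : nat -> R) (s : seq nat) (N : nat) :
  uniq s -> all P s -> (forall p, P p -> (p <= N)%N -> 0 <= F p) ->
  (forall p, P p -> (N < p)%N -> F p <= 0) ->
  \sum_(p <- s) F p <= \sum_(0 <= p < N.+1 | P p) F p.
Proof.
move=> us /allP sP F0 F1; rewrite (bigID (fun p => p <= N)%N) /=.
rewrite [leRHS](bigID (fun p => p \in s)) /=.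
have -> : \sum_(p <- s | (p <= N)%N) F p = \sum_(0 <= p < N.+1 | P p && (p \in s)) F p.
  rewrite -big_filter -[RHS]big_filter; apply: perm_big; apply: uniq_perm.
  - by rewrite filter_uniq.
  - by rewrite filter_uniq // iota_uniq.
  move=> p; rewrite !mem_filter mem_index_iota /= ltnS.
  by case: (boolP (p \in s)) => [/sP ->|_]; rewrite ?andbT ?andbF.
rewrite lerD2l; apply: (@le_trans _ _ 0).
  rewrite big_seq_cond; apply: sumr_le0 => p /andP[/sP Pp].
  by rewrite -ltnNge; exact: F1.
rewrite big_seq_cond; apply: sumr_ge0 => p.
by rewrite mem_index_iota ltnS => /andP[/andP[_ pN] /andP[Pp _]]; exact: F0.
Qed.

Lemma totient_ratio (m : nat) : (0 < m)%N ->
  m%:R = (totient m)%:R * \prod_(p <- primes m) (p%:R / (p%:R - 1)) :> R.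
Proof.
move=> m0; rewrite totientE // {1}(prod_prime_decomp m0) prime_decompE big_map /=.
rewrite !natr_prod -big_split /= big_seq [RHS]big_seq; apply: eq_bigr => p.
move=> pm; have := pm; rewrite mem_primes => /and3P[pp _ _].
have p2 := prime_ge2 R pp.
have : (0 < logn p m)%N by rewrite logn_gt0.
case: (logn p m) => // k _ /=; rewrite natrM !natrX exprS.
have -> : p.-1%:R = p%:R - 1 :> R by rewrite -subn1 natrB ?prime_gt0.
by field; rewrite gt_eqF //; lra.
Qed.

Lemma prod_predp_dvd_totient (m : nat) : (0 < m)%N ->
  (\prod_(p <- primes m) p.-1 %| totient m)%N.
Proof.
move=> m0; rewrite totientE // big_split /=; exact: dvdn_mulr.
Qed.

Lemma sum_ln_predp_le (m : nat) : (0 < m)%N ->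
  \sum_(p <- primes m) ln (p%:R - 1) <= ln (totient m)%:R :> R.
Proof.
move=> m0; have := dvdn_leq _ (prod_predp_dvd_totient m0).
rewrite totient_gt0 => /(_ m0) h.
have -> : \sum_(p <- primes m) ln (p%:R - 1) = ln (\prod_(p <- primes m) p.-1)%:R :> R.
  rewrite natr_prod big_seq [in RHS]big_seq ln_prod; last first.
    move=> p; rewrite mem_primes => /andP[pp _]; rewrite ltr0n -subn1 subn_gt0.
    exact: prime_gt1.
  apply: eq_bigr => p; rewrite mem_primes => /andP[pp _].
  by rewrite -subn1 natrB ?prime_gt0.
apply: ln_mono; last by rewrite ler_nat.
rewrite ltr0n big_seq prodn_cond_gt0 // => p; rewrite mem_primes => /andP[pp _].
by rewrite -subn1 subn_gt0; exact: prime_gt1.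
Qed.

Lemma inv_le_ln_ratio (p : nat) : prime p -> p%:R^-1 <= ln (p%:R / (p%:R - 1)) :> R.
Proof.
move=> pp; have p2 := prime_ge2 R pp.
have h : 0 < p%:R / (p%:R - 1) :> R by rewrite divr_gt0; lra.
apply: le_trans (ln_ge_subV h); rewrite invf_div.
have -> : 1 - (p%:R - 1) / p%:R = p%:R^-1 :> R by field; rewrite gt_eqF //; lra.
exact: lexx.
Qed.

Lemma ln_ratio_le_inv (p : nat) : prime p -> ln (p%:R / (p%:R - 1)) <= (p%:R - 1)^-1 :> R.
Proof.
move=> pp; have p2 := prime_ge2 R pp.
have h : 0 < p%:R / (p%:R - 1) :> R by rewrite divr_gt0; lra.
apply: le_trans (ln_le_subr1 h) _.
have -> : p%:R / (p%:R - 1) - 1 = (p%:R - 1)^-1 :> R by field; rewrite gt_eqF //; lra.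
exact: lexx.
Qed.

Definition theta_pred (N : nat) : R := \sum_(0 <= p < N.+1 | prime p) ln (p%:R - 1).

Lemma sum_primes_exchange (m N : nat) (X : R) : (2 <= N)%N -> (0 < m)%N ->
  (totient m)%:R <= X ->
  \sum_(p <- primes m) ln (p%:R / (p%:R - 1)) <=
  mertens_sum R N + (ln X - theta_pred N) / (N%:R * ln N%:R).
Proof.
move=> N2 m0 mX.
have N0 : 0 < N%:R :> R by rewrite ltr0n; lia.
have L0 : 0 < ln N%:R :> R by apply: ln_gt0; rewrite ltr1n.
(* The multiplier: [1 / p <= ln (p / (p - 1)) <= 1 / (p - 1)] and [sg * ln N = 1 / N] fix the sign
   on each side of [N]. *)
set sg := (N%:R * ln N%:R)^-1 : R.
have sg0 : 0 < sg by rewrite invr_gt0 mulr_gt0.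
have sgL : sg * ln N%:R = N%:R^-1 by rewrite /sg; field; rewrite !gt_eqF.
have : \sum_(p <- primes m) (ln (p%:R / (p%:R - 1)) - sg * ln (p%:R - 1)) <=
  \sum_(0 <= p < N.+1 | prime p) (ln (p%:R / (p%:R - 1)) - sg * ln (p%:R - 1)).
  apply: sum_exchange; first exact: primes_uniq.
- by apply/allP => p; rewrite mem_primes => /andP[].
- move=> p pp pN; have p2 := prime_ge2 R pp; rewrite subr_ge0.
  apply: le_trans (inv_le_ln_ratio pp).
  apply: (@le_trans _ _ N%:R^-1).
    rewrite -sgL ler_pM2l // ln_mono //; first lra.
    by have : p%:R <= N%:R :> R; [rewrite ler_nat | lra].
  by rewrite lef_pV2 ?posrE ?ler_nat //; lra.
- move=> p pp pN; have p2 := prime_ge2 R pp; rewrite subr_le0.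
  have h : N%:R <= p%:R - 1 :> R.
    by rewrite lerBrDr natr1 ler_nat.
  apply: le_trans (ln_ratio_le_inv pp) _.
  apply: (@le_trans _ _ N%:R^-1); first by rewrite lef_pV2 ?posrE //; lra.
  by rewrite -sgL ler_pM2l // ln_mono.
rewrite !sumrB -!big_distrr /= -/(mertens_sum R N) -/(theta_pred N) => H.
have h1 := sum_ln_predp_le m0.
have h2 : ln (totient m)%:R <= ln X by apply: ln_mono => //; rewrite ltr0n totient_gt0.
have h3 : sg * \sum_(p <- primes m) ln (p%:R - 1) <= sg * ln X.
  by rewrite ler_pM2l //; apply: le_trans h2.
by rewrite mulrC mulrBr; lra.
Qed.

Lemma nat_le_ratio (m n : nat) (y : R) : (0 < m)%N -> (totient m <= n)%N ->
  \sum_(p <- primes m) ln (p%:R / (p%:R - 1)) <= y -> m%:R <= n%:R * expR y.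
Proof.
move=> m0 mn h; rewrite (totient_ratio m0) ler_pM ?ler_nat //.
  rewrite big_seq prodr_ge0 // => p; rewrite mem_primes => /andP[pp _].
  by have p2 := prime_ge2 R pp; rewrite divr_ge0; lra.
move: h; rewrite big_seq -ln_prod -?big_seq; last first.
  move=> p; rewrite mem_primes => /andP[pp _].
  by have p2 := prime_ge2 R pp; rewrite divr_gt0; lra.
rewrite -ler_expR lnK // posrE.
rewrite big_seq prodr_gt0 // => p; rewrite mem_primes => /andP[pp _].
by have p2 := prime_ge2 R pp; rewrite divr_gt0; lra.
Qed.
End TotientRatio.

(** * Numerical constants *)

Section Numerics.
Variable R : realType.

(** Twenty terms of the series at 1/2 leave an error of [2 ^ - 20], and the ends are rounded
    outward. The next three bounds reduce to smaller primes through [1 - 1/3 = 2/3], [1 - 1/5 = 4/5]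
    and [1 - 1/7 = 6/7]. *)
Lemma ln2_bounds : 192 / 277 <= ln (2 : R) <= 253 / 365.
Proof.
have /(neg_ln1B_bounds 20) : 0 < (1 / 2 : R) < 1 by lra.
have -> : (1 - 1 / 2 : R) = (1 / 2) by lra.
have -> : - ln (1 / 2) = ln 2 :> R.
  by rewrite -lnV ?posrE ?invf_div ?ln_div ?posrE; rewrite ?ln1; lra.
rewrite invf_div !big_ord_recr big_ord0 /= => /andP[h1 h2].
by lra.
Qed.

Lemma ln3_bounds : 1103 / 1004 <= ln (3 : R) <= 479 / 436.
Proof.
have /(neg_ln1B_bounds 12) : 0 < (1 / 3 : R) < 1 by lra.
have -> : (1 - 1 / 3 : R) = (2 / 3) by lra.
have -> : - ln (2 / 3) = ln 3 - ln 2 :> R.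
  by rewrite -lnV ?posrE ?invf_div ?ln_div ?posrE; lra.
rewrite invf_div !big_ord_recr big_ord0 /= => /andP[h1 h2].
by have := ln2_bounds; lra.
Qed.

Lemma ln5_bounds : 581 / 361 <= ln (5 : R) <= 272 / 169.
Proof.
have /(neg_ln1B_bounds 9) : 0 < (1 / 5 : R) < 1 by lra.
have -> : (1 - 1 / 5 : R) = ((2 * 2) / 5) by lra.
have -> : - ln ((2 * 2) / 5) = ln 5 - (ln 2 + ln 2) :> R.
  by rewrite -lnV ?posrE ?invf_div ?ln_div ?posrE; rewrite ?lnM ?posrE; lra.
rewrite invf_div !big_ord_recr big_ord0 /= => /andP[h1 h2].
by have := ln2_bounds; lra.
Qed.

Lemma ln7_bounds : 755 / 388 <= ln (7 : R) <= 72 / 37.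
Proof.
have /(neg_ln1B_bounds 6) : 0 < (1 / 7 : R) < 1 by lra.
have -> : (1 - 1 / 7 : R) = ((2 * 3) / 7) by lra.
have -> : - ln ((2 * 3) / 7) = ln 7 - (ln 2 + ln 3) :> R.
  by rewrite -lnV ?posrE ?invf_div ?ln_div ?posrE; rewrite ?lnM ?posrE; lra.
rewrite invf_div !big_ord_recr big_ord0 /= => /andP[h1 h2].
by have := ln2_bounds; have := ln3_bounds; lra.
Qed.

Lemma euler_gamma_ge : 576 / 1000 <= euler_gamma R.
Proof.
(* Subtracting [1 / (2 n)] turns the decreasing sequence into one that increases to the same limit;
   its value at 10 is about 0.5764. *)
pose a (n : nat) : R := euler_gamma_seq R n - (2 * n%:R)^-1.
have aS n : (10 <= n)%N -> a n <= a n.+1.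
  move=> n10; have n0 : 10 <= n%:R :> R by rewrite (ler_nat R 10).
  rewrite /a /euler_gamma_seq seriesSr /= -[n.+1%:R]natr1.
  set x := n%:R in n0 *.
  have /(neg_ln1B_bounds 3) /andP[_] : 0 < 1 / (x + 1) < 1.
    by rewrite divr_gt0 ?ltr_pdivrMr; lra.
  have -> : - ln (1 - 1 / (x + 1)) = ln (x + 1) - ln x.
    have e : (1 - 1 / (x + 1))^-1 = (x + 1) / x by field; rewrite !gt_eqF //; lra.
    rewrite -lnV ?posrE ?subr_gt0 ?e ?ln_div ?posrE //; try lra.
    by rewrite ltr_pdivrMr; lra.
  rewrite !big_ord_recr big_ord0 /= => h.
  suff : 0 <= (x + 1)^-1 - (2 * (x + 1))^-1 + (2 * x)^-1 - (ln (x + 1) - ln x).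
    by move: (series _ _) (_^-1) (_^-1) (_^-1) (ln _) (ln _) => b c d e f g; lra.
  rewrite subr_ge0; apply: le_trans h _; rewrite -subr_ge0.
  set y := (X in 0 <= X).
  (* Three terms of the series suffice: what remains has the sign of [x - 3]. *)
  have -> : y = (x - 3) / (6 * x * (x + 1) ^+ 3).
    by rewrite /y; field; rewrite !gt_eqF //; lra.
  by rewrite divr_ge0 ?mulr_ge0 ?exprn_ge0; lra.
have a10 n : (10 <= n)%N -> a 10%N <= a n.
  by move/subnK <-; elim: (n - 10)%N => // k IH; apply: le_trans IH (aS _ _); lia.
apply: limr_ge; first exact: is_cvg_euler_gamma_seq.
exists 10%N => // n n10; apply: (@le_trans _ _ (a n)); last first.
  by rewrite /a gerBl invr_ge0 mulr_ge0.
apply: le_trans (a10 n n10).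
rewrite /a /euler_gamma_seq /series /= !big_nat_recr //= big_geq //.
have -> : 10 = 2 * 5 :> R by lra.
rewrite lnM ?posrE; try lra.
by have := ln2_bounds; have := ln5_bounds; lra.
Qed.
End Numerics.

(** * The bound with the Chebyshev function cancelled *)

Section Asymptotic.
Variable R : realType.

(** Over all integers from 2 to [N] the factors [k / (k - 1)] telescope to [N]; the primes give only
    some of them. *)
Lemma mertens_sum_le_ln (N : nat) : (0 < N)%N -> mertens_sum R N <= ln N%:R.
Proof.
elim: N => // -[_ _|N IH _].
  by rewrite /mertens_sum big_mkcond !big_nat_recr //= big_geq // ln1 !addr0.
rewrite /mertens_sum big_mkcond big_nat_recr //= -big_mkcond -/(mertens_sum R N.+1).
have {}IH := IH isT.
have h : ln N.+1%:R <= ln N.+2%:R :> R by apply: ln_mono; rewrite ?ltr0n ?ler_nat.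
have E : N.+2%:R - 1 = N.+1%:R :> R by rewrite -[N.+2%:R]natr1 addrK.
rewrite E; case: ifP => _; last by rewrite addr0; apply: le_trans h.
by rewrite ln_div ?posrE ?ltr0n //; move: IH; move: (ln _) (ln _) => x y; lra.
Qed.

Lemma theta_sub_pred (N : nat) : theta R N - theta_pred R N = mertens_sum R N.
Proof.
rewrite /theta /theta_pred -sumrB; apply: eq_bigr => p pp.
by have p2 := prime_ge2 R pp; rewrite ln_div ?posrE //; lra.
Qed.

Lemma sum_primes_le_gamma (m N : nat) (X : R) : (3 <= N)%N -> (0 < m)%N ->
  (totient m)%:R <= X ->
  \sum_(p <- primes m) ln (p%:R / (p%:R - 1)) <=
  ln (ln N%:R) + euler_gamma R
  + (sum_lnp_ppredp R N + (3 * ln N%:R + 2 + ln X) / N%:R) / ln N%:R.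
Proof.
move=> N3 m0 mX; have N2 : (2 <= N)%N by lia.
have N0 : 0 < N%:R :> R by rewrite ltr0n; lia.
have L0 : 0 < ln N%:R :> R by apply: ln_gt0; rewrite ltr1n; lia.
apply: le_trans (sum_primes_exchange N2 m0 mX) _.
have h1 := mertens_upper R N2.
have h2 := sum_lnp_predp_le R (ltnW N2).
have h3 : mertens_sum R N <= ln N%:R by apply: mertens_sum_le_ln; lia.
have h4 := theta_sub_pred N.
set L := ln N%:R in L0 h1 h2 h3 *; set c := (sum_lnp_predp R N - L + 1 + N%:R^-1) in h1.
have hc : c <= sum_lnp_ppredp R N + (2 + L + theta R N) / N%:R.
  have e : (2 + L + theta R N) / N%:R = (1 + L + theta R N) / N%:R + N%:R^-1.
    by field; rewrite gt_eqF.
  by rewrite /c e; move: h2; move: (N%:R^-1) ((1 + L + _) / _) => x y; lra.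
have {}h1 : mertens_sum R N <= ln L + euler_gamma R + c / L + N%:R^-1 by [].
have hcL : c / L <= (sum_lnp_ppredp R N + (2 + L + theta R N) / N%:R) / L.
  by rewrite ler_pM2r ?invr_gt0.
have hX : (ln X - theta_pred R N) / (N%:R * L) <= (ln X - theta R N + L) / (N%:R * L).
  by rewrite ler_pM2r ?invr_gt0 ?mulr_gt0 //; lra.
(* The three [L] come from the Stirling error, from the term [1 / N], and from replacing
   [theta_pred] by [theta]; the two [theta] terms cancel. *)
have e : (sum_lnp_ppredp R N + (3 * L + 2 + ln X) / N%:R) / L =
  (sum_lnp_ppredp R N + (2 + L + theta R N) / N%:R) / L
  + N%:R^-1 + (ln X - theta R N + L) / (N%:R * L).
  by field; rewrite !gt_eqF.
rewrite e; move: h1 hcL hX; move: (c / L) (_ / L) (_ / (_ * _)) (_ / (_ * _)) (N%:R^-1).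
by move=> x1 x2 x3 x4 x5; lra.
Qed.

(** Integral test over all integers: [- (ln x + 1) / x] is an antiderivative of [ln x / x ^ 2], and
    the extra [1 / K] absorbs the discretisation error. *)
Lemma sum_lnp_ppredp_tail (K N : nat) : (0 < K)%N -> (K <= N)%N ->
  sum_lnp_ppredp R N <= sum_lnp_ppredp R K + (ln K%:R + 1 + K%:R^-1) / K%:R - (ln N%:R + 1 + K%:R^-1) / N%:R.
Proof.
move=> K0; have K0' : 0 < K%:R :> R by rewrite ltr0n.
elim: N => [|N IH]; first by rewrite leqn0 => /eqP E; rewrite E in K0.
rewrite leq_eqVlt => /orP[/eqP <-|]; first by rewrite addrK.
rewrite ltnS => KN; have {}IH := IH KN.
have KN' : K%:R <= N%:R :> R by rewrite ler_nat.
have N0 : 0 < N%:R :> R by apply: lt_le_trans KN'.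
have N1 : 0 < N.+1%:R :> R by rewrite ltr0n.
rewrite {1}/sum_lnp_ppredp big_mkcond big_nat_recr //= -big_mkcond -/(sum_lnp_ppredp R N).
apply: le_trans (lerD IH (lexx _)) _.
have l1 : 0 <= ln N.+1%:R :> R by apply: ln_ge0; rewrite ler1n.
set y : R := if _ then _ else _.
have hy : y <= ln N.+1%:R / (N.+1%:R * N%:R).
  rewrite /y -[N.+1%:R]natr1 addrK natr1; case: ifP => // _.
  by rewrite divr_ge0 // mulr_ge0 // ltW.
suff h : ln N.+1%:R / (N.+1%:R * N%:R) <=
   (ln N%:R + 1 + K%:R^-1) / N%:R - (ln N.+1%:R + 1 + K%:R^-1) / N.+1%:R :> R.
  by apply: le_trans (lerD (lexx _) (le_trans hy h)) _; rewrite addrA subrK.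
have hl := ln_sub_le N1 N0.
have E1 : N.+1%:R - N%:R = 1 :> R by rewrite -natr1; ring.
rewrite E1 mul1r in hl.
have hK : N%:R^-1 <= K%:R^-1 :> R by rewrite lef_pV2 ?posrE.
rewrite -subr_ge0.
set z := (X in 0 <= X).
have -> : z = (N.+1%:R * (ln N%:R - ln N.+1%:R + N%:R^-1) + (K%:R^-1 - N%:R^-1))
    / (N.+1%:R * N%:R).
  rewrite /z -[N.+1%:R]natr1; move: (ln _) (ln _) => u v.
  by field; rewrite !gt_eqF //; lra.
apply: divr_ge0; last by rewrite mulr_ge0 // ltW.
apply: addr_ge0; last by rewrite subr_ge0.
apply: mulr_ge0; first exact: ltW.
by move: hl; move: (N%:R^-1) (ln N%:R) (ln N.+1%:R) => a b c; lra.
Qed.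

Lemma sum_lnp_ppredp_le1 (N : nat) : (13 <= N)%N -> sum_lnp_ppredp R N <= 1.
Proof.
move=> N13; apply: le_trans (sum_lnp_ppredp_tail (isT : (0 < 13)%N) N13) _.
have N0 : 0 < N%:R :> R by rewrite ltr0n; lia.
have h : 0 <= (ln N%:R + 1 + 13^-1) / N%:R :> R.
  have : 0 <= ln N%:R :> R by apply: ln_ge0; rewrite ler1n; lia.
  by move=> ?; apply: divr_ge0; [lra | exact: ltW].
have -> : sum_lnp_ppredp R 13 = ln 2 / (2 * (2 - 1)) + ln 3 / (3 * (3 - 1)) + ln 5 / (5 * (5 - 1))
   + ln 7 / (7 * (7 - 1)) + ln 11 / (11 * (11 - 1)) + ln 13 / (13 * (13 - 1)).
  by rewrite /sum_lnp_ppredp big_mkcond !big_nat_recr //= big_geq // !(addr0, add0r).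
have l11 : ln 11 <= ln 2 + ln 2 + ln 3 :> R.
  by rewrite -!lnM ?posrE; try lra; apply: ln_mono; lra.
have l13 : ln 13 <= ln 2 + ln 7 :> R.
  by rewrite -!lnM ?posrE; try lra; apply: ln_mono; lra.
have := ln2_bounds R; have := ln3_bounds R; have := ln5_bounds R; have := ln7_bounds R.
have -> : (2 - 1 : R) = 1 by lra.
have -> : (3 - 1 : R) = 2 by lra.
have -> : (5 - 1 : R) = 4 by lra.
have -> : (7 - 1 : R) = 6 by lra.
have -> : (11 - 1 : R) = 10 by lra.
have -> : (13 - 1 : R) = 12 by lra.
move=> /andP[_ ?] /andP[_ ?] /andP[_ ?] /andP[_ ?]; lra.
Qed.
End Asymptotic.

(** * The range [6 <= t' <= 960] *)

Definition Nprod (f : nat -> nat) (s : seq nat) : N :=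
  foldr (fun p a => N.mul (N.of_nat (f p)) a) 1%num s.

Lemma NprodE f s : N.to_nat (Nprod f s) = (\prod_(p <- s) f p)%N.
Proof.
elim: s => [|p s IH]; first by rewrite big_nil.
by rewrite big_cons -IH /= Nnat.N2Nat.inj_mul Nnat.Nat2N.id.
Qed.

Definition prime_list (n : nat) : seq nat := [seq p <- index_iota 0 n.+1 | prime p].

(* Certifies [\prod_(p <= n) p / (p - 1) <= x / y] and
   [2 ^ h <= (\prod_(p <= n) (p - 1)) ^ 2] in binary arithmetic. *)
Definition prime_check (n : nat) (x y h : N) : bool :=
  let s := prime_list n in
  let P := Nprod predn s in
  N.leb (N.mul y (Nprod id s)) (N.mul x P) && N.leb (N.pow 2 h) (N.mul P P).

Lemma leq_of_Nleb a b : N.leb a b -> (N.to_nat a <= N.to_nat b)%N.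
Proof. by move=> /N.leb_le h; lia. Qed.

Local Ltac ln_lra R :=
  move: (ln2_bounds R) (ln3_bounds R) (ln5_bounds R) (ln7_bounds R);
  move: (@ln R 2) (@ln R 3) (@ln R 5) (@ln R 7) => l2 l3 l5 l7
    /andP[? ?] /andP[? ?] /andP[? ?] /andP[? ?]; lra.

Section Pieces.
Variable R : realType.

(** The product of the [p - 1] is certified squared so that the exponent [h / 2] may be a
    half-integer. *)
Lemma prime_checkP (n : nat) (x y h : N) : (0 < N.to_nat y)%N -> prime_check n x y h ->
  mertens_sum R n <= ln ((N.to_nat x)%:R / (N.to_nat y)%:R) /\
  (N.to_nat h)%:R / 2 * ln 2 <= theta_pred R n.
Proof.
move=> y0 /andP[/leq_of_Nleb h1 /leq_of_Nleb h2].
rewrite !Nnat.N2Nat.inj_mul Nnat.N2Nat.inj_pow !NprodE in h1 h2.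
rewrite (_ : Nat.pow _ _ = (2 ^ N.to_nat h)%N) in h2; last first.
  by elim: (N.to_nat h) => //= k ->; rewrite expnS; lia.
set A := (\prod_(p <- _) id p)%N in h1; set B := (\prod_(p <- _) predn p)%N in h1 h2.
have pl p : p \in prime_list n -> prime p by rewrite mem_filter => /andP[].
have B0 : (0 < B)%N.
  by rewrite /B big_seq prodn_cond_gt0 // => p /pl /prime_gt1; lia.
have A0 : (0 < A)%N.
  by rewrite /A big_seq prodn_cond_gt0 // => p /pl /prime_gt0.
have thE : theta_pred R n = ln B%:R.
  rewrite /theta_pred -big_filter -/(prime_list n) /B natr_prod big_seq.
  rewrite [in RHS]big_seq ln_prod => [|p /pl /prime_gt1]; last by rewrite ltr0n; lia.
  by apply: eq_bigr => p /pl pp; rewrite -subn1 natrB ?prime_gt0.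
have WE : mertens_sum R n = ln (A%:R / B%:R).
  rewrite ln_div ?posrE ?ltr0n // -thE -theta_sub_pred; congr (_ - _).
  rewrite /theta -big_filter -/(prime_list n) /A natr_prod big_seq.
  by rewrite [in RHS]big_seq ln_prod // => p /pl /prime_gt0; rewrite ltr0n.
split.
  rewrite WE ln_mono ?divr_gt0 ?ltr0n //.
  rewrite ler_pdivrMr ?ltr0n // mulrAC ler_pdivlMr ?ltr0n //.
  by rewrite -!natrM ler_nat mulnC.
rewrite thE.
have : ln (2 ^+ N.to_nat h) <= ln (B%:R * B%:R) :> R.
  by apply: ln_mono; rewrite ?exprn_gt0 // -natrX -natrM ler_nat.
rewrite lnXn // lnM ?posrE ?ltr0n // -[ln 2 *+ _]mulr_natl.
by move: ((N.to_nat h)%:R) (ln B%:R) => u v; lra.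
Qed.

Definition lnw (t : R) : R := ln t + ln (ln t + ln (ln t)).

(** The milestones [s2], [s3], [s4] bound the nested logarithms one level at a time; with rational
    milestones only logarithms of rationals have to be estimated. *)
Lemma lnw_ge (a t s2 s3 s4 : R) : 0 < a -> a <= t -> 0 < s2 -> s2 <= ln a ->
  0 < s3 -> s3 <= ln a + ln s2 -> s4 <= ln a + ln s3 -> s4 <= lnw t.
Proof.
move=> a0 at_ s20 h2 s30 h3 h4.
have k1 := ln_mono a0 at_.
have k2 : ln s2 <= ln (ln t) by apply: ln_mono => //; lra.
have k3 : ln s3 <= ln (ln t + ln (ln t)) by apply: ln_mono => //; lra.
by rewrite /lnw; lra.
Qed.

(** Logarithms of 7-smooth rationals are linear in those of 2, 3, 5 and 7, so comparisons between
    them become linear arithmetic. *)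
Lemma ln_smooth (q : R) (a b c d a' b' c' d' : nat) :
  q * (2 ^+ a' * 3 ^+ b' * 5 ^+ c' * 7 ^+ d') = 2 ^+ a * 3 ^+ b * 5 ^+ c * 7 ^+ d ->
  ln q = a%:R * ln 2 + b%:R * ln 3 + c%:R * ln 5 + d%:R * ln 7
       - (a'%:R * ln 2 + b'%:R * ln 3 + c'%:R * ln 5 + d'%:R * ln 7).
Proof.
have pos i j k l : 0 < 2 ^+ i * 3 ^+ j * 5 ^+ k * 7 ^+ l :> R.
  by rewrite !mulr_gt0 // exprn_gt0.
have lnP i j k l : ln (2 ^+ i * 3 ^+ j * 5 ^+ k * 7 ^+ l) =
    i%:R * ln 2 + j%:R * ln 3 + k%:R * ln 5 + l%:R * ln 7 :> R.
  by rewrite !lnM ?posrE ?mulr_gt0 ?exprn_gt0 // !lnXn // !mulr_natl.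
move=> qE; have -> : q = (2 ^+ a * 3 ^+ b * 5 ^+ c * 7 ^+ d) /
    (2 ^+ a' * 3 ^+ b' * 5 ^+ c' * 7 ^+ d').
  by rewrite -qE mulfK // gt_eqF.
by rewrite ln_div ?posrE // !lnP.
Qed.

(** Milestones for [lnw_ge] at [a = 6], rounded down to 7-smooth fractions, then the last premise of
    [lnw_range]: [35 / 8] is the product of [p / (p - 1)] over primes up to 8, the range ends at
    [b = 8], and [h = 11]. The next four lemmas follow this pattern, with the product rounded up. *)
Lemma lnw_num6 : [/\ (16 / 9) <= ln 6 :> R, (189 / 80) <= ln 6 + ln (16 / 9) :> R,
  (500 / 189) <= ln 6 + ln (189 / 80) :> R &
  ln (35 / 8) + (8 - 1 - 11 / 2) / (3 * 2 ^ 3)%N%:R <= 576 / 1000 + ln (500 / 189) :> R].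
Proof.
rewrite (_ : 3 * 2 ^ 3 = 24)%N //.
rewrite (@ln_smooth 6 1 1 0 0 0 0 0 0)
  ?(@ln_smooth (16 / 9) 4 0 0 0 0 2 0 0)
  ?(@ln_smooth (189 / 80) 0 3 0 1 4 0 1 0)
  ?(@ln_smooth (500 / 189) 2 0 3 0 0 3 0 1)
  ?(@ln_smooth (35 / 8) 0 0 1 1 3 0 0 0); try lra.
by split; ln_lra R.
Qed.

Lemma lnw_num8 : [/\ (56 / 27) <= ln 8 :> R, (14 / 5) <= ln 8 + ln (56 / 27) :> R,
  (108 / 35) <= ln 8 + ln (14 / 5) :> R &
  ln (256 / 49) + (16 - 1 - 24 / 2) / (4 * 2 ^ 4)%N%:R <= 576 / 1000 + ln (108 / 35) :> R].
Proof.
rewrite (_ : 4 * 2 ^ 4 = 64)%N //.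
rewrite (@ln_smooth 8 3 0 0 0 0 0 0 0)
  ?(@ln_smooth (56 / 27) 3 0 0 1 0 3 0 0)
  ?(@ln_smooth (14 / 5) 1 0 0 1 0 0 1 0)
  ?(@ln_smooth (108 / 35) 2 3 0 0 0 0 1 1)
  ?(@ln_smooth (256 / 49) 8 0 0 0 0 0 0 2); try lra.
by split; ln_lra R.
Qed.

Lemma lnw_num16 : [/\ (135 / 49) <= ln 16 :> R, (189 / 50) <= ln 16 + ln (135 / 49) :> R,
  (49 / 12) <= ln 16 + ln (189 / 50) :> R &
  ln (160 / 21) + (54 - 1 - 147 / 2) / (6 * 2 ^ 6)%N%:R <= 576 / 1000 + ln (49 / 12) :> R].
Proof.
rewrite (_ : 6 * 2 ^ 6 = 384)%N //.
rewrite (@ln_smooth 16 4 0 0 0 0 0 0 0)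
  ?(@ln_smooth (135 / 49) 0 3 1 0 0 0 0 2)
  ?(@ln_smooth (189 / 50) 0 3 0 1 1 0 2 0)
  ?(@ln_smooth (49 / 12) 0 0 0 2 2 1 0 0)
  ?(@ln_smooth (160 / 21) 5 0 1 0 0 1 0 1); try lra.
by split; ln_lra R.
Qed.

Lemma lnw_num54 : [/\ (250 / 63) <= ln 54 :> R, (16 / 3) <= ln 54 + ln (250 / 63) :> R,
  (45 / 8) <= ln 54 + ln (16 / 3) :> R &
  ln (10 / 1) + (320 - 1 - 663 / 2) / (8 * 2 ^ 8)%N%:R <= 576 / 1000 + ln (45 / 8) :> R].
Proof.
rewrite (_ : 8 * 2 ^ 8 = 2048)%N //.
rewrite (@ln_smooth 54 1 3 0 0 0 0 0 0)
  ?(@ln_smooth (250 / 63) 1 0 3 0 0 2 0 1)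
  ?(@ln_smooth (16 / 3) 4 0 0 0 0 1 0 0)
  ?(@ln_smooth (45 / 8) 0 2 1 0 3 0 0 0)
  ?(@ln_smooth (10 / 1) 1 0 1 0 0 0 0 0); try lra.
by split; ln_lra R.
Qed.

Lemma lnw_num300 : [/\ (256 / 45) <= ln 300 :> R, (200 / 27) <= ln 300 + ln (256 / 45) :> R,
  (192 / 25) <= ln 300 + ln (200 / 27) :> R &
  ln (10 / 1) + (960 - 1 - 663 / 2) / (8 * 2 ^ 8)%N%:R <= 576 / 1000 + ln (192 / 25) :> R].
Proof.
rewrite (_ : 8 * 2 ^ 8 = 2048)%N //.
rewrite (@ln_smooth 300 2 1 2 0 0 0 0 0)
  ?(@ln_smooth (256 / 45) 8 0 0 0 0 2 1 0)
  ?(@ln_smooth (200 / 27) 3 0 2 0 0 3 0 0)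
  ?(@ln_smooth (192 / 25) 6 1 0 0 0 0 2 0)
  ?(@ln_smooth (10 / 1) 1 0 1 0 0 0 0 0); try lra.
by split; ln_lra R.
Qed.

End Pieces.

Section Finite.
Variable R : realType.
Variables (m n : nat) (t : R).
Hypotheses (m0 : (0 < m)%N) (n0 : (0 < n)%N) (mn : (totient m <= n)%N).
Hypothesis tE : ln n%:R = (t - 1) * ln 2.

(** With [N = 2 ^ j] and [theta_pred] bounded below by a multiple of [ln 2], the factor [ln 2]
    cancels from the exchange term. Here [n] stands for the theorem's [2 * n], whence the [t - 1] in
    [tE]. *)
Lemma lnw_range (j : nat) (x y h : N) (a b s2 s3 s4 : R) :
  (0 < j)%N -> (0 < N.to_nat y)%N -> prime_check (2 ^ j) x y h ->
  0 < a -> a <= t -> t <= b -> 0 < s2 -> s2 <= ln a ->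
  0 < s3 -> s3 <= ln a + ln s2 -> 0 < s4 -> s4 <= ln a + ln s3 ->
  ln ((N.to_nat x)%:R / (N.to_nat y)%:R) + (b - 1 - (N.to_nat h)%:R / 2) / (j * 2 ^ j)%:R
    <= 576 / 1000 + ln s4 ->
  m%:R <= n%:R * (expR (euler_gamma R) * lnw t).
Proof.
move=> j0 y0 /(prime_checkP R y0) [hW hT] a0 at_ tb s20 h2 s30 h3 s40 h4 H.
have hw := lnw_ge a0 at_ s20 h2 s30 h3 h4.
have l2 : 0 < ln 2 :> R by have := ln2_bounds R; lra.
have N2 : (2 <= 2 ^ j)%N by rewrite -{1}(expn1 2) leq_pexp2l.
have mX : (totient m)%:R <= n%:R :> R by rewrite ler_nat.
have hs := sum_primes_exchange N2 m0 mX.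
apply: le_trans (nat_le_ratio m0 mn hs) _.
rewrite ler_pM2l ?ltr0n //.
apply: (@le_trans _ _ (expR (euler_gamma R) * s4)); last by rewrite ler_pM2l ?expR_gt0.
rewrite -[s4]lnK ?posrE // -expRD ler_expR.
apply: (@le_trans _ _ (576 / 1000 + ln s4)); last first.
  by rewrite lerD2r; exact: euler_gamma_ge.
apply: le_trans H; apply: lerD => //.
rewrite natrX lnXn // -[ln 2 *+ _]mulr_natl.
have jN : 0 < (j * 2 ^ j)%:R :> R by rewrite ltr0n muln_gt0 j0 expn_gt0.
have -> : 2 ^+ j * (j%:R * ln 2) = (j * 2 ^ j)%:R * ln 2 :> R.
  by rewrite natrM natrX; ring.
rewrite ler_pdivrMr ?mulr_gt0 // mulrA divfK ?gt_eqF // tE; nra.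
Qed.

Lemma lnw_bound_6_8 : 6 <= t -> t <= 8 ->
  m%:R <= n%:R * (expR (euler_gamma R) * lnw t).
Proof.
have ck : prime_check (2 ^ 3) 35 8 11 by vm_compute.
have y0 : (0 < N.to_nat 8)%N by [].
have [q2 q3 q4 q5] := lnw_num6 R.
move=> t1 t2; apply: (lnw_range (isT : (0 < 3)%N) y0 ck _ t1 t2 _ q2 _ q3 _ q4 q5);
  by rewrite ?divr_gt0 ?ltr0Sn.
Qed.

Lemma lnw_bound_8_16 : 8 <= t -> t <= 16 ->
  m%:R <= n%:R * (expR (euler_gamma R) * lnw t).
Proof.
have ck : prime_check (2 ^ 4) 256 49 24 by vm_compute.
have y0 : (0 < N.to_nat 49)%N by [].
have [q2 q3 q4 q5] := lnw_num8 R.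
move=> t1 t2; apply: (lnw_range (isT : (0 < 4)%N) y0 ck _ t1 t2 _ q2 _ q3 _ q4 q5);
  by rewrite ?divr_gt0 ?ltr0Sn.
Qed.

Lemma lnw_bound_16_54 : 16 <= t -> t <= 54 ->
  m%:R <= n%:R * (expR (euler_gamma R) * lnw t).
Proof.
have ck : prime_check (2 ^ 6) 160 21 147 by vm_compute.
have y0 : (0 < N.to_nat 21)%N by [].
have [q2 q3 q4 q5] := lnw_num16 R.
move=> t1 t2; apply: (lnw_range (isT : (0 < 6)%N) y0 ck _ t1 t2 _ q2 _ q3 _ q4 q5);
  by rewrite ?divr_gt0 ?ltr0Sn.
Qed.

Lemma lnw_bound_54_320 : 54 <= t -> t <= 320 ->
  m%:R <= n%:R * (expR (euler_gamma R) * lnw t).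
Proof.
have ck : prime_check (2 ^ 8) 10 1 663 by vm_compute.
have y0 : (0 < N.to_nat 1)%N by [].
have [q2 q3 q4 q5] := lnw_num54 R.
move=> t1 t2; apply: (lnw_range (isT : (0 < 8)%N) y0 ck _ t1 t2 _ q2 _ q3 _ q4 q5);
  by rewrite ?divr_gt0 ?ltr0Sn.
Qed.

Lemma lnw_bound_300_960 : 300 <= t -> t <= 960 ->
  m%:R <= n%:R * (expR (euler_gamma R) * lnw t).
Proof.
have ck : prime_check (2 ^ 8) 10 1 663 by vm_compute.
have y0 : (0 < N.to_nat 1)%N by [].
have [q2 q3 q4 q5] := lnw_num300 R.
move=> t1 t2; apply: (lnw_range (isT : (0 < 8)%N) y0 ck _ t1 t2 _ q2 _ q3 _ q4 q5);
  by rewrite ?divr_gt0 ?ltr0Sn.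
Qed.

End Finite.

(** * The range [960 <= t'] *)

Section Large.
Variable R : realType.

(* Convexity of [expR]: [x |-> (expR x - 1) / x] increases. *)
Lemma mul_expR_div_le (a L0 L : R) : 0 < L0 -> L0 <= L ->
  L * expR (a / L) <= L + L0 * (expR (a / L0) - 1).
Proof.
move=> l0 l1; have L_gt0 := lt_le_trans l0 l1.
set z := a / L; set x := a / L0.
have zx : z = L0 / L * x by rewrite /z /x; field; rewrite !gt_eqF.
(* The tangent of [expR] at [z] is evaluated at [x] and at 0, with weights [L0] and [L - L0]; the
   linear terms cancel because [z * L = L0 * x]. *)
have h1 : expR z * (1 + (x - z)) <= expR x.
  have -> : expR x = expR z * expR (x - z) by rewrite -expRD addrC subrK.
  by rewrite ler_pM2l ?expR_gt0 // expR_ge1Dx.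
have h2 : expR z * (1 - z) <= 1.
  rewrite -(expRxMexpNx_1 z) ler_pM2l ?expR_gt0 // expRxMexpNx_1.
  exact: expR_ge1Dx.
have zL : z * L = L0 * x by rewrite zx; field; rewrite gt_eqF.
have h1' : L0 * (expR z * (1 + (x - z))) <= L0 * expR x by rewrite ler_pM2l.
have h2' : (L - L0) * (expR z * (1 - z)) <= (L - L0) * 1.
  by rewrite ler_wpM2l // subr_ge0.
have e : L * expR z = L0 * (expR z * (1 + (x - z))) + (L - L0) * (expR z * (1 - z)).
  have -> : L0 * (expR z * (1 + (x - z))) + (L - L0) * (expR z * (1 - z)) =
    L * expR z + expR z * (L0 * x - z * L) by ring.
  by rewrite zL subrr mulr0 addr0.
by rewrite e; lra.
Qed.

Lemma ln648_ge : 647 / 100 <= ln 648 :> R.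
Proof. by rewrite (@ln_smooth _ 648 3 4 0 0 0 0 0 0); [ln_lra R | lra]. Qed.

Lemma ln640_le : ln 640 <= 647 / 100 :> R.
Proof. by rewrite (@ln_smooth _ 640 7 0 1 0 0 0 0 0); [ln_lra R | lra]. Qed.

Lemma ln36div25_ge : 364 / 1000 <= ln (36 / 25) :> R.
Proof. by rewrite (@ln_smooth _ (36 / 25) 2 2 0 0 0 0 2 0); [ln_lra R | lra]. Qed.

Lemma ln27div4_ge : 190 / 100 <= ln (27 / 4) :> R.
Proof. by rewrite (@ln_smooth _ (27 / 4) 0 3 0 0 2 0 0 0); [ln_lra R | lra]. Qed.

Lemma ln216div25_ge : 215 / 100 <= ln (216 / 25) :> R.
Proof. by rewrite (@ln_smooth _ (216 / 25) 3 3 0 0 0 0 2 0); [ln_lra R | lra]. Qed.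

Lemma expR_204div647_le : expR (204 / 100 / (647 / 100)) <= 441 / 320 :> R.
Proof.
have -> : 204 / 100 / (647 / 100) = 204 / 647 :> R by field.
have p : 0 < 441 / 320 :> R by lra.
rewrite -[leRHS]lnK ?posrE // ler_expR.
by rewrite (@ln_smooth _ (441 / 320) 0 2 0 2 6 0 1 0); [ln_lra R | lra].
Qed.

(** Convexity bounds the left side by [ln x] plus less than 2.45; on the right,
    [ln (36 / 25) >= 0.364] and a nested logarithm of at least 2.15 add more than 2.51. *)
Lemma lnw_large_num (x t : R) : 664 < x -> 36 / 25 * x <= t ->
  ln x * expR (204 / 100 / ln x) <= lnw t.
Proof.
move=> x664 xt.
have L0 : 647 / 100 <= ln x by apply: le_trans ln648_ge (ln_mono _ _); lra.
have ht : 364 / 1000 + ln x <= ln t.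
  apply: le_trans (lerD ln36div25_ge (lexx (ln x))) _.
  by rewrite -lnM ?posrE; [apply: ln_mono|..]; lra.
have pos : 0 < 647 / 100 :> R by lra.
apply: le_trans (mul_expR_div_le (204 / 100) pos L0) _.
have k2 : 190 / 100 <= ln (ln t).
  by apply: le_trans ln27div4_ge (ln_mono _ _); move: L0 ht; clear; lra.
have k3 : 215 / 100 <= ln (ln t + ln (ln t)).
  by apply: le_trans ln216div25_ge (ln_mono _ _); move: L0 ht k2; clear; lra.
by have := expR_204div647_le; rewrite /lnw; move: L0 ht k3; clear; lra.
Qed.

Lemma lnw_bound_960 (m n : nat) (t : R) : (0 < m)%N -> (0 < n)%N -> (totient m <= n)%N ->
  ln n%:R = (t - 1) * ln 2 -> 960 <= t ->
  m%:R <= n%:R * (expR (euler_gamma R) * lnw t).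
Proof.
move=> m0 n0 mn tE t960.
(* [N] is the integer just above [ln n]. As [36 / 25] is slightly less than [1 / ln 2], the
   inequality [36 / 25 * N <= t] survives the rounding, and [t >= 960] forces [N > 664]. *)
have [N [N13 N664 NLa tN]] : exists N : nat,
    [/\ (13 <= N)%N, 664 < N%:R :> R, ln n%:R <= N%:R :> R & 36 / 25 * N%:R <= t].
  have /andP[l1 l2] := ln2_bounds R.
  have h1 : (t - 1) * (192 / 277) <= ln n%:R by rewrite tE ler_pM2l; lra.
  have h2 : ln n%:R <= (t - 1) * (253 / 365) by rewrite tE ler_pM2l; lra.
  move: h1 h2; move: (ln n%:R) => y h1 h2.
  have h3 := truncnS_gt y; exists (Num.truncn y).+1.
  have h4 : (Num.truncn y).+1%:R - 1 <= y.
    by rewrite -natr1 addrK truncn_le; lra.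
  move: h3 h4; move: (Num.truncn y).+1 => N h3 h4.
  have N664 : 664 < N%:R :> R by lra.
  by split; [rewrite -(ler_nat R)|..]; lra.
have N0 : 0 < N%:R :> R by lra.
have N3 : (3 <= N)%N by exact: leq_trans N13.
set La := ln n%:R in tE NLa *; clear tE t960.
have L0 : 0 < ln N%:R :> R by apply: ln_gt0; lra.
have LN : (3 * ln N%:R + 2) / N%:R <= 4 / 100 :> R.
  have h : ln N%:R - ln 640 <= (N%:R - 640) / 640 :> R by apply: ln_sub_le; lra.
  by rewrite ler_pdivrMr //; have := ln640_le; lra.
have mX : (totient m)%:R <= n%:R :> R by rewrite ler_nat.
(* The error 2.04 is 1 for [sum_lnp_ppredp], 1 for [ln n / N] and 0.04 for [LN]. *)
have hs : \sum_(p <- primes m) ln (p%:R / (p%:R - 1)) <=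
    ln (ln N%:R) + euler_gamma R + 204 / 100 / ln N%:R.
  apply: le_trans (sum_primes_le_gamma N3 m0 mX) _.
  rewrite lerD2l ler_pM2r ?invr_gt0 // -/La.
  have D1 := sum_lnp_ppredp_le1 R N13.
  have h1 : La / N%:R <= 1 by rewrite ler_pdivrMr // mul1r.
  rewrite [(_ + La) / _]mulrDl.
  by move: LN h1 D1; clear; move: ((_ + 2) / _) (La / _) => u v; lra.
apply: le_trans (nat_le_ratio m0 mn hs) _.
rewrite ler_pM2l ?ltr0n // [ln (ln _) + _]addrC -addrA !expRD ler_pM2l ?expR_gt0 //.
by rewrite lnK ?posrE //; exact: lnw_large_num.
Qed.

Lemma lnw_bound (m n : nat) (t : R) : (0 < m)%N -> (0 < n)%N -> (totient m <= n)%N ->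
  ln n%:R = (t - 1) * ln 2 -> 6 <= t ->
  m%:R <= n%:R * (expR (euler_gamma R) * lnw t).
Proof.
move=> m0 n0 mn tE t6.
case: (leP t 8) => [t8|/ltW t8]; first exact: lnw_bound_6_8.
case: (leP t 16) => [t16|/ltW t16]; first exact: lnw_bound_8_16.
case: (leP t 54) => [t54|/ltW t54]; first exact: lnw_bound_16_54.
case: (leP t 320) => [t320|/ltW t320]; first exact: lnw_bound_54_320.
case: (leP t 960) => [t960|/ltW t960]; last exact: lnw_bound_960.
by apply: lnw_bound_300_960 => //; lra.
Qed.

End Large.

(** * The theorem *)

Section Small.
Variable R : realType.

Lemma ln_ratio_noninc (p q : nat) : prime p -> (p <= q)%N ->
  ln (q%:R / (q%:R - 1)) <= ln (p%:R / (p%:R - 1)) :> R.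
Proof.
move=> pp pq; have p2 := prime_ge2 R pp.
have pq' : p%:R <= q%:R :> R by rewrite ler_nat.
apply: ln_mono; first by rewrite divr_gt0; lra.
rewrite ler_pdivrMr; last lra.
by rewrite mulrAC ler_pdivlMr; lra.
Qed.

(** Each odd prime of [m] contributes an even factor [p - 1] to a divisor of [totient m]. *)
Lemma odd_primes_le (m k : nat) : (0 < m)%N -> ~~ (2 ^ k %| totient m)%N ->
  (size [seq p <- primes m | odd p] < k)%N.
Proof.
move=> m0; apply: contraR; rewrite -leqNgt => hk.
apply: dvdn_trans (prod_predp_dvd_totient m0).
rewrite (bigID odd) /= -big_filter; apply: dvdn_mulr.
have : all (fun p => prime p && odd p) [seq p <- primes m | odd p].
  by apply/allP => p; rewrite mem_filter mem_primes => /andP[-> /andP[->]].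
move=> hall; apply: (dvdn_trans (dvdn_exp2l 2 hk)); move: hall.
elim: [seq p <- primes m | odd p] => [|p s IH] //= /andP[/andP[pp po] ps].
rewrite big_cons expnS dvdn_mul ?IH //.
by rewrite dvdn2 -subn1 oddB ?prime_gt0 // po.
Qed.

Lemma ratio_few_odd_primes (m : nat) : (0 < m)%N ->
  (size [seq p <- primes m | odd p] <= 4)%N ->
  \sum_(p <- primes m) ln (p%:R / (p%:R - 1)) <= ln (77 / 16) :> R.
Proof.
move=> m0 h4; pose w (p : nat) : R := ln (p%:R / (p%:R - 1)).
have w0 p : prime p -> 0 <= w p.
  move=> pp; apply: le_trans (inv_le_ln_ratio R pp); rewrite invr_ge0 //.
rewrite (bigID odd) /= -big_filter.
set s := [seq p <- primes m | odd p] in h4 *.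
have h2 : \sum_(p <- primes m | ~~ odd p) w p <= ln 2.
  have us : uniq [seq p <- primes m | ~~ odd p] by rewrite filter_uniq ?primes_uniq.
  rewrite -big_filter.
  apply: le_trans (@sum_exchange R (pred1 2%N) w _ 2 us _ _ _) _.
  - apply/allP => p; rewrite mem_filter mem_primes /= => /andP[po /andP[pp _]].
    by case: (even_prime pp) => [->//|oo]; rewrite oo in po.
  - by move=> p /eqP -> _; apply: w0.
  - by move=> p /eqP ->.
  rewrite big_mkcond !big_nat_recr //= big_geq // !addr0 add0r.
  by rewrite /w (_ : 2 - 1 = 1 :> R) ?divr1 //; lra.
(* Subtracting [w 11] puts the sign change at 11, so the exchange compares with 3, 5, 7, 11; since
   [size s <= 4], adding it back costs at most [4 * w 11]. *)
have hs : \sum_(p <- s) (w p - w 11) <=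
    \sum_(0 <= p < 12 | prime p && odd p) (w p - w 11).
  apply: (@sum_exchange R (fun p => prime p && odd p)).
  - by rewrite filter_uniq ?primes_uniq.
  - by apply/allP => p; rewrite mem_filter mem_primes => /andP[-> /andP[->]].
  - by move=> p /andP[pp _] p11; rewrite subr_ge0 ln_ratio_noninc.
  - by move=> p /andP[pp _] p11; rewrite subr_le0 ln_ratio_noninc // ltnW.
rewrite sumrB big_const_seq count_predT iter_addr addr0 in hs.
have E : \sum_(0 <= p < 12 | prime p && odd p) (w p - w 11) =
    w 3 - w 11 + (w 5 - w 11) + (w 7 - w 11) + (w 11 - w 11).
  by rewrite big_mkcond !big_nat_recr //= big_geq // !(addr0, add0r).
rewrite {}E in hs.
have hk : w 11 *+ size s <= w 11 *+ 4 by apply: ler_wpMn2l => //; apply: w0.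
have e : ln (77 / 16) = w 3 + w 5 + w 7 + w 11 + ln 2.
  have wE p : w p.+1 = ln (p.+1%:R / p%:R) by rewrite /w -[in X in _ / X]natr1 addrK.
  rewrite !wE; have -> : 77 / 16 = 3 / 2 * (5 / 4) * (7 / 6) * (11 / 10) * 2 :> R by lra.
  by rewrite !lnM ?posrE //; lra.
rewrite e; move: h2 hs hk; rewrite -/w.
by move: (\sum_(p <- s) _) (\sum_(p <- _ | _) _) (w 11 *+ size s) => x y z; lra.
Qed.
End Small.

Theorem theorem5 (R : realType) (n : nat) (n_gt0 : (0 < n)%N)
    (n_even : (2 %| n)%N)
    (t : nat) (t_def : t = (logn 2 n + 2)%N)
    (t' : R) (t'_def : t' = ln n%:R / ln 2 + 2) :
  (Phi n_gt0)%:R <=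
    (if ~~ (16 %| n)%N then (9 + 625 / 1000) * n%:R
     else 2 * n%:R * expR (euler_gamma R)
          * (1 + 1 / (ln t' + ln (ln t')) ^+ 2)
          * (ln t' + ln (ln t' + ln (ln t')))) :> R.
Proof.
rewrite /Phi; case: ex_maxnP => m /= /andP[m0 mdvd] _.
have n20 : (0 < 2 * n)%N by rewrite muln_gt0.
have mn : (totient m <= 2 * n)%N by exact: dvdn_leq.
case: ifP => n16.
  (* If [2 ^ 5] divided [totient m] it would divide [2 * n], and 16 would divide [n]. The constant
     is then [2 * 77 / 16 = 9.625]. *)
  have few : (size [seq p <- primes m | odd p] <= 4)%N.
    rewrite -ltnS; apply: odd_primes_le => //; apply: contra n16 => h.
    by rewrite -(@dvdn_pmul2l 2) //; apply: dvdn_trans mdvd.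
  apply: le_trans (nat_le_ratio m0 mn (ratio_few_odd_primes R m0 few)) _.
  by rewrite lnK ?posrE; [rewrite natrM; lra | lra].
have l2 : 0 < ln 2 :> R by apply: ln_gt0; lra.
have n0 : 0 < n%:R :> R by rewrite ltr0n.
have tE : ln (2 * n)%:R = (t' - 1) * ln 2.
  by rewrite natrM lnM ?posrE // t'_def; field; rewrite gt_eqF.
have t6 : 6 <= t'.
  have n16' : 16 <= n%:R :> R.
    by rewrite (ler_nat R 16); apply: dvdn_leq => //; move/negbFE: n16.
  have : ln (2 ^+ 4) <= ln n%:R :> R by apply: ln_mono; lra.
  rewrite lnXn // => h; have : 4 + 2 <= t'.
    by rewrite t'_def lerD2r ler_pdivlMr // mulr_natl.
  by clear; lra.
have := lnw_bound m0 n20 mn tE t6; rewrite natrM -/(lnw t') => /le_trans; apply.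
(* Nonnegativity of [lnw t'] allows multiplying by the factor [1 + 1 / (ln t' + ln (ln t')) ^+ 2],
   which is at least 1. *)
have w0 : 0 <= lnw t'.
  have [q2 q3 q4 _] := lnw_num6 R.
  by apply: le_trans (lnw_ge _ t6 _ q2 _ q3 q4); lra.
rewrite -!mulrA ler_wpM2l // ler_wpM2l // ler_wpM2l ?expR_ge0 // ler_peMl //.
by rewrite lerDl divr_ge0 ?sqr_ge0.
Qed.
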